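(* Let $q\geq 4$. The graphicahedron $\mathcal{P}_{K_{1,q}}$ is the universal regular $q$-polytope with graphicahedra $\mathcal{P}_{K_{1,q-1}}$ as facets and with $(q-1)$-simplices $\{3^{q-2}\}$ as vertex-figures; that is, $\mathcal{P}_{K_{1,q}} = \{\mathcal{P}_{K_{1,q-1}},\{3^{q-2}\}\}$. Moreover, $\Gamma(\mathcal{P}_{K_{1,q}}) \cong S_{q+1}\times S_q$, a direct product.
   Context: An abstract $n$-polytope (abstract polytope of rank $n$) is a partially ordered set $\mathcal{P}$ with a strictly monotone rank function with range $\{-1,0,\ldots,n\}$, whose elements are called faces ($j$-faces if of rank $j$; vertices for $j=0$, facets for $j=n-1$), such that: there is a smallest face $F_{-1}$ and a largest face $F_n$; every flag (maximal totally ordered subset) contains exactly $n+2$ faces, one of each rank; any two flags $\Phi,\Psi$ can be joined by a sequence of flags, all containing $\Phi\cap\Psi$, with successive flags adjacent (differing in exactly one face); and whenever $F\le F'$ with $\mathrm{rank}(F)=j-1$, $\mathrm{rank}(F')=j+1$, there are exactly two $j$-faces $F''$ with $F\le F''\le F'$. For faces $F\le F'$ the section $F'/F=\{F''\mid F\le F''\le F'\}$ is an abstract polytope; a facet $F$ is identified with the polytope $F/F_{-1}$, and the vertex-figure at a vertex $F$ is $F_n/F$. $\Gamma(\mathcal{P})$ denotes the automorphism group (order-preserving bijections with order-preserving inverse). $\mathcal{P}$ is regular if $\Gamma(\mathcal{P})$ is transitive on flags; then, for a fixed base flag $\Phi$, $\Gamma(\mathcal{P})$ is generated by its distinguished generators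 $\rho_0,\ldots,\rho_{n-1}$, where $\rho_j$ is the automorphism mapping $\Phi$ to the unique flag differing from $\Phi$ exactly in its $j$-face. If regular $n$-polytopes $\mathcal{P}_1$ and $\mathcal{P}_2$ are the facets and vertex-figures, respectively, of some regular $(n+1)$-polytope, then there is (up to isomorphism) a universal such $(n+1)$-polytope, denoted $\{\mathcal{P}_1,\mathcal{P}_2\}$: it is a regular $(n+1)$-polytope with facets isomorphic to $\mathcal{P}_1$ and vertex-figures isomorphic to $\mathcal{P}_2$, of which any other regular $(n+1)$-polytope with facets $\mathcal{P}_1$ and vertex-figures $\mathcal{P}_2$ is a quotient (in particular, there is a group epimorphism from the automorphism group of $\{\mathcal{P}_1,\mathcal{P}_2\}$ onto that of the other polytope taking distinguished generators to distinguished generators in order). $\{3^{q-2}\}$ denotes the $(q-1)$-simplex (its face lattice, as an abstract regular polytope of rank $q-1$). Graphicahedron: let $G$ be a finite connected simple graph with vertex set $V(G)=\{1,\ldots,p\}$ and edge set $E(G)$ of size $q$. For an edge $e=\{i,j\}$ let $\tau_e=(i\;j)\in S_p$, and for $K\subseteq E(G)$ let $T_K=\langle\tau_e\mid e\in K\rangle\le S_p$. The faces of rank $i$ ($0\le i\le q$) of the graphicahedron $\mathcal{P}_G$ are the equivalence classes of pairs $(K,\alpha)$ with $K\subseteq E(G)$, $|K|=i$, $\alpha\in S_p$, where $(K,\alpha)\sim(L,\beta)$ iff $K=L$ and $T_K\alpha=T_L\beta$ (right cosets). The order is $(K,\alpha)\le(L,\beta)$ iff $K\subseteq L$ and $T_K\alpha\subseteq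 T_L\beta$. A smallest face of rank $-1$ is appended. $\mathcal{P}_G$ is an abstract $q$-polytope. $K_{1,q}$ is the $q$-star: the graph with $q+1$ vertices and $q$ edges, all emanating from one central vertex. It is known that $\mathcal{P}_{K_{1,q}}$ is a regular $q$-polytope. $S_n$ is the symmetric group on $n$ letters. *)

(* Defs.v *)
(* Flags are classical sets of faces, not finite sets: the polytopes over which
   universality quantifies are not assumed finite. *)
From HB Require Import structures.
From mathcomp Require Import all_boot all_order all_algebra all_fingroup.
From mathcomp Require Import generic_quotient.
From mathcomp Require Import boolp classical_sets functions.

Set Implicit Arguments.
Unset Strict Implicit.
Unset Printing Implicit Defensive.

Import Order.TTheory Order.SetSubsetOrder.Exports.

Local Open Scope order_scope.

Definition poset_iso d d' (S : porderType d) (T : porderType d') : Prop :=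
  exists f : S -> T, bijective f /\ {mono f : x y / x <= y}.

Definition psection d (T : porderType d) (a b : T) : Type :=
  {x : T | a <= x <= b}.
HB.instance Definition _ d (T : porderType d) (a b : T) :=
  SubChoice.on (psection a b).
HB.instance Definition _ d (T : porderType d) (a b : T) :=
  [SubChoice_isSubPOrder of psection a b by <: with d].

Section Automorphisms.
Context {d : Order.disp_t} {T : porderType d}.

Record paut : Type := PAut {
  paut_fun :> T -> T;
  paut_inv : T -> T;
  paut_funK : cancel paut_fun paut_inv;
  paut_invK : cancel paut_inv paut_fun;
  paut_fun_homo : {homo paut_fun : x y / x <= y};
  paut_inv_homo : {homo paut_inv : x y / x <= y} }.

Lemma pautP (g h : paut) : g =1 h -> g = h.
Proof.
case: g h => [f f' fK f'K hf hf'] [g g' gK g'K hg hg'] /= /funext fg.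
have fg' : f' = g'.
  by apply: funext => x; rewrite -{1}(g'K x) -fg fK.
by subst g g'; congr PAut; exact: Prop_irrelevance.
Qed.

Definition paut1 : paut :=
  @PAut id id (fun _ => erefl) (fun _ => erefl)
    (fun _ _ xy => xy) (fun _ _ xy => xy).

Definition pautV (g : paut) : paut :=
  PAut (@paut_invK g) (@paut_funK g) (@paut_inv_homo g) (@paut_fun_homo g).

(* Automorphisms act on the right: g * h is "first g, then h", the convention
   of MathComp for permutations. *)
Definition pautM (g h : paut) : paut :=
  @PAut (h \o g) (paut_inv g \o paut_inv h)
    (can_comp (@paut_funK h) (@paut_funK g))
    (can_comp (@paut_invK g) (@paut_invK h))
    (fun _ _ xy => paut_fun_homo h (paut_fun_homo g xy))
    (fun _ _ xy => paut_inv_homo g (paut_inv_homo h xy)).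

HB.instance Definition _ := gen_eqMixin paut.
HB.instance Definition _ := gen_choiceMixin paut.

Fact pautMA : associative pautM. Proof. by move=> f g h; exact: pautP. Qed.
Fact paut1M : left_id paut1 pautM. Proof. by move=> g; exact: pautP. Qed.
Fact pautM1 : right_id paut1 pautM. Proof. by move=> g; exact: pautP. Qed.
Fact pautVM : left_inverse paut1 pautV pautM.
Proof. by move=> g; apply: pautP; exact: paut_invK. Qed.
Fact pautMV : right_inverse paut1 pautV pautM.
Proof. by move=> g; apply: pautP; exact: paut_funK. Qed.

HB.instance Definition _ := isGroup.Build paut pautMA paut1M pautM1
  pautVM pautMV.

End Automorphisms.
Arguments paut {d} T.

Definition group_iso (G H : groupType) : Prop :=
  exists f : {multiplicative G -> H}, bijective f.

Record rposet : Type := RPoset {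
  rposet_disp : Order.disp_t;
  face :> porderType rposet_disp;
  rank : face -> int }.

Section Polytopes.
Local Open Scope classical_set_scope.
Implicit Types P Q : rposet.

Definition chain P (Phi : set P) : Prop := total_on Phi (fun x y => x <= y).

Definition flag P (Phi : set P) : Prop :=
  chain Phi /\ forall Psi : set P, chain Psi -> Phi `<=` Psi -> Psi = Phi.

Definition adjacent_at P (j : int) (Phi Psi : set P) : Prop :=
  Phi <> Psi /\ forall x : P, rank x <> j -> (Phi x <-> Psi x).

(* As each flag has exactly one face of each rank, two flags differ in exactly
   one face when they are distinct and agree in all ranks but one. *)
Definition adjacent P (Phi Psi : set P) : Prop :=
  exists j, adjacent_at j Phi Psi.

Definition flag_joined P (Phi Psi : set P) : Prop :=
  exists (k : nat) (c : nat -> set P),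
    [/\ c 0%N = Phi, c k = Psi,
        forall i, (i <= k)%N -> flag (c i) /\ Phi `&` Psi `<=` c i
      & forall i, (i < k)%N -> adjacent (c i) (c i.+1)].

Definition smallest_face P (x : P) : Prop := forall y : P, x <= y.
Definition largest_face P (x : P) : Prop := forall y : P, y <= x.

Record polytope (n : nat) P : Prop := {
  rank_mono : {homo @rank P : x y / x < y >-> (x < y)%R};
  rank_range : range (@rank P) = [set i : int | (-1 <= i <= n%:Z)%R];
  ex_smallest : exists x : P, smallest_face x;
  ex_largest : exists x : P, largest_face x;
  flag_ranks : forall Phi : set P, flag Phi ->
    forall i : int, (-1 <= i <= n%:Z)%R -> exists! x : P, Phi x /\ rank x = i;
  flag_connected : forall Phi Psi : set P,
    flag Phi -> flag Psi -> flag_joined Phi Psi;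
  diamond : forall (j : int) (x y : P), x <= y ->
    rank x = (j - 1)%R -> rank y = (j + 1)%R ->
    exists z1 z2 : P,
      z1 <> z2 /\ [set z | rank z = j /\ x <= z <= y] = [set z1; z2] }.

Definition regular_polytope (n : nat) P : Prop :=
  polytope n P /\
  forall Phi Psi : set P, flag Phi -> flag Psi ->
    exists g : paut P, [set g x | x in Phi] = Psi.

(* rho j is the automorphism of P mapping the base flag Phi to the flag that
   differs from Phi exactly in its j-face. *)
Definition distinguished_generators (n : nat) P (Phi : set P)
    (rho : 'I_n -> paut P) : Prop :=
  forall j : 'I_n, adjacent_at (nat_of_ord j)%:Z Phi [set rho j x | x in Phi].

(* A facet y is identified with the section y/F_{-1}; the vertex-figure at a
   vertex x is the section F_n/x. *)
Definition has_facets (n : nat) P d (F : porderType d) : Prop :=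
  forall x y : P, smallest_face x -> rank y = (n%:Z - 1)%R ->
    poset_iso (psection x y) F.

Definition has_vertex_figures P d (V : porderType d) : Prop :=
  forall x y : P, rank x = 0%R -> largest_face y -> poset_iso (psection x y) V.

Definition paut_orbit P (N : {pred paut P}) (x : P) : set P :=
  [set g x | g in [set` N]].

(* Q is isomorphic to the quotient P/N for some subgroup N of the automorphism
   group of P: the faces of P/N are the N-orbits on P, and one orbit is below
   another when some member of the first is below some member of the second. *)
Definition is_quotient P Q : Prop :=
  exists N : {pred paut P}, group_closed N /\
  exists f : Q -> set P,
    set_bij [set: Q] (range (paut_orbit N)) f /\
    forall u v : Q, u <= v <-> exists x y : P, [/\ f u x, f v y & x <= y].

Definition generator_epimorphism (n : nat) P Q : Prop :=
  forall (Phi : set P) (Psi : set Q), flag Phi -> flag Psi ->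
    exists f : {multiplicative paut P -> paut Q},
      (forall h, exists g, f g = h) /\
      forall rho sigma,
        distinguished_generators (n := n) Phi rho ->
        distinguished_generators Psi sigma ->
        forall j, f (rho j) = sigma j.

(* P is the universal regular n-polytope {F, V} with facets F and
   vertex-figures V. *)
Definition is_universal (n : nat) P d d' (F : porderType d) (V : porderType d')
    : Prop :=
  [/\ regular_polytope n P, has_facets n P F, has_vertex_figures P V &
      forall Q : rposet, regular_polytope n Q ->
        has_facets n Q F -> has_vertex_figures Q V ->
        is_quotient P Q /\ generator_epimorphism n P Q].

End Polytopes.

(* The face lattice of the n-simplex: a face is its set of vertices. *)
Definition simplex (n : nat) : rposet :=
  @RPoset _
    (Order.SetSubsetOrder.type Order.SetSubsetOrder.subset_display 'I_n.+1 : Type)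
    (fun A : {set 'I_n.+1} => (#|A|%:Z - 1)%R).

Record cgraph (p : nat) : Type := CGraph {
  gadj :> rel 'I_p;
  gadj_sym : symmetric gadj;
  gadj_irr : irreflexive gadj;
  gadj_connected : forall x y, connect gadj x y }.

Section Star.
Variable q : nat.

Definition star_adj : rel 'I_q.+1 :=
  fun x y => (x == ord0) != (y == ord0).

Fact star_adj_sym : symmetric star_adj.
Proof. by move=> x y; rewrite /star_adj eq_sym. Qed.

Fact star_adj_irr : irreflexive star_adj.
Proof. by move=> x; rewrite /star_adj eqxx. Qed.

Fact star_adj_connected x y : connect star_adj x y.
Proof.
have c0 z : connect star_adj ord0 z.
  case: (eqVneq z ord0) => [->|z0]; first exact: connect0.
  by apply: connect1; rewrite /star_adj eqxx (negPf z0).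
apply: connect_trans (c0 y).
by rewrite (sym_connect_sym star_adj_sym).
Qed.

(* The q-star K_{1,q}, with central vertex 0. *)
Definition star : cgraph q.+1 :=
  CGraph star_adj_sym star_adj_irr star_adj_connected.

End Star.

Section Graphicahedron.
Local Open Scope group_scope.
Local Open Scope quotient_scope.
Variables (p : nat) (G : cgraph p).

Definition edges : {set {set 'I_p}} :=
  [set [set x.1; x.2] | x : 'I_p * 'I_p & G x.1 x.2].

(* The group T_K generated by the transpositions (i j), {i, j} in K. *)
Definition trgrp (K : {set {set 'I_p}}) : {group 'S_p} :=
  <<[set tperm x.1 x.2 | x : 'I_p * 'I_p & [set x.1; x.2] \in K]>>%G.

Definition gpair : Type := {x : {set {set 'I_p}} * 'S_p | x.1 \subset edges}.
HB.instance Definition _ := Choice.on gpair.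

(* The right coset T_K alpha of a pair (K, alpha). *)
Definition gpair_coset (x : gpair) : {set 'S_p} :=
  trgrp (val x).1 :* (val x).2.

Definition gpair_equiv (x y : gpair) : bool :=
  ((val x).1 == (val y).1) && (gpair_coset x == gpair_coset y).

Definition gpair_le (x y : gpair) : bool :=
  ((val x).1 \subset (val y).1) && (gpair_coset x \subset gpair_coset y).

Fact gpair_equiv_refl : reflexive gpair_equiv.
Proof. by move=> x; rewrite /gpair_equiv !eqxx. Qed.

Fact gpair_equiv_sym : symmetric gpair_equiv.
Proof. by move=> x y; rewrite /gpair_equiv eq_sym [X in _ && X]eq_sym. Qed.

Fact gpair_equiv_trans : transitive gpair_equiv.
Proof.
by move=> y x z /andP[/eqP e1 /eqP e2]; rewrite /gpair_equiv e1 e2.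
Qed.

Canonical gpair_equivRel :=
  EquivRel gpair_equiv gpair_equiv_refl gpair_equiv_sym gpair_equiv_trans.

Definition gclass : Type := {eq_quot gpair_equiv}.
HB.instance Definition _ := Choice.on gclass.

Definition gclass_of (x : gpair) : gclass := \pi_({eq_quot gpair_equiv}) x.
Definition gclass_repr (x : gclass) : gpair := repr (x : {eq_quot gpair_equiv}).
Definition gclass_le (x y : gclass) : bool :=
  gpair_le (gclass_repr x) (gclass_repr y).
Definition gclass_rank (x : gclass) : nat := #|(val (gclass_repr x)).1|.

Lemma gclass_reprK : cancel gclass_repr gclass_of.
Proof. by move=> x; exact: reprK. Qed.

Lemma gclass_ofE x y : (gclass_of x = gclass_of y) <-> gpair_equiv x y.
Proof. by split=> [/eqmodP|xy] //; apply/eqmodP. Qed.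

Lemma gclass_of_repr x : gpair_equiv (gclass_repr (gclass_of x)) x.
Proof. by apply/gclass_ofE; exact: gclass_reprK. Qed.

Lemma gclass_le_of x y : gclass_le (gclass_of x) (gclass_of y) = gpair_le x y.
Proof.
have [/andP[/eqP x1 /eqP x2] /andP[/eqP y1 /eqP y2]] :=
  (gclass_of_repr x, gclass_of_repr y).
by rewrite /gclass_le /gpair_le x1 x2 y1 y2.
Qed.

Lemma gclass_rank_of x : gclass_rank (gclass_of x) = #|(val x).1|.
Proof. by have /andP[/eqP e _] := gclass_of_repr x; rewrite /gclass_rank e. Qed.

Fact gclass_le_refl : reflexive gclass_le.
Proof. by move=> x; rewrite /gclass_le /gpair_le !subxx. Qed.

Fact gclass_le_anti : antisymmetric gclass_le.
Proof.
move=> x y /andP[/andP[k1 c1] /andP[k2 c2]].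
rewrite -(gclass_reprK x) -(gclass_reprK y); apply/gclass_ofE.
by rewrite /gpair_equiv !finset.eqEsubset k1 k2 c1 c2.
Qed.

Fact gclass_le_trans : transitive gclass_le.
Proof.
move=> y x z /andP[k1 c1] /andP[k2 c2]; rewrite /gclass_le /gpair_le.
by rewrite (fintype.subset_trans k1 k2) (fintype.subset_trans c1 c2).
Qed.

(* None is the face of rank -1. *)
Definition gface : Type := option gclass.
HB.instance Definition _ := Choice.on gface.

Definition gface_le (x y : gface) : bool :=
  match x, y with
  | None, _ => true
  | Some _, None => false
  | Some u, Some v => gclass_le u v
  end.

Fact gface_le_refl : reflexive gface_le.
Proof. by case=> //= x; exact: gclass_le_refl. Qed.

Fact gface_le_anti : antisymmetric gface_le.
Proof. by case=> [x|] [y|] //= /gclass_le_anti ->. Qed.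

Fact gface_le_trans : transitive gface_le.
Proof. by case=> [y|] [x|] [z|] //=; exact: gclass_le_trans. Qed.

Fact gface_display : Order.disp_t. Proof. exact: Order.Disp tt tt. Qed.

HB.instance Definition _ := Order.Le_isPOrder.Build gface_display gface
  gface_le_refl gface_le_anti gface_le_trans.

Definition gface_rank (x : gface) : int :=
  if x is Some u then (gclass_rank u)%:Z%R else (-1)%R.

Definition graphicahedron : rposet := @RPoset _ gface gface_rank.

End Graphicahedron.

(* Main.v *)
Require Import Defs.
From HB Require Import structures.
From mathcomp Require Import boolp classical_sets.
From mathcomp Require Import all_boot all_order all_algebra all_fingroup.
From mathcomp Require Import zify.

Set Implicit Arguments.
Unset Strict Implicit.
Unset Printing Implicit Defensive.

Import Order.TTheory.

(** Number the vertices of K_{1,q} so that 0 is the centre and the leaves are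
    1, ..., q.  A set of edges is then a set J of leaves, and T_J is the group
    of the permutations that fix every leaf outside J; so a face (J, b) of the
    graphicahedron P amounts to J together with the restriction of b to the
    leaves outside J ([star_face_le]).  On this description S_(q+1) acts by
    right translations and S_q by relabelling the leaves, and both actions
    commute.  Flags correspond to pairs (order p of the leaves, permutation b),
    on which S_(q+1) x S_q is simply transitive; since an automorphism that
    fixes a flag is trivial, this product is the whole group
    ([star_group_iso]).  That P is a polytope is seen on the same description:
    flags are joined by swapping neighbours in the order of the leaves and by
    multiplying b by transpositions (0 j) ([star_flag_connected]).

    For universality let Q be a regular q-polytope with the given facets and
    vertex-figures, fix a flag of Q, and identify a facet and a vertex-figure
    through that flag with their models.  Every automorphism of such a section
    extends to exactly one automorphism of Q ([extension_morphism]).  So the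
    group of Q contains images of S_q x S_(q-1), from the facet, and of S_q,
    from the vertex-figure; they agree on the common S_(q-1)
    and the generator tau = (0 1) of the facet group commutes with the last
    generator of the vertex-figure group, as their indices differ by at
    least 2.  The conjugates t_1, ..., t_q of tau under the image of S_q are
    therefore permuted by S_q like the leaves.  The group S_(q+1) is presented
    on the transpositions (0 i) by relations in which at most three indices
    occur ([star_presentation]).  For q >= 4 any three leaves can be moved by
    S_q into a facet, where the relations are known to hold; this is
    where q >= 4 is used.  Hence (0 i) |-> t_i extends to S_(q+1), and with the
    image of S_q this yields a morphism from the group of P to that of Q that
    preserves distinguished generators ([star_group_morphism]).

    Finally, such a morphism f makes Q a quotient of P: the stabilizer of a
    face of the base flag is generated by the generators of the other ranks
    ([stabilizer_ind]), so f maps stabilizers onto stabilizers, and the fibres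
    of the induced map from the faces of P to those of Q are the orbits of the
    kernel of f ([quotient_of_morphism]). *)

(** * Symmetric groups presented by star transpositions *)

Section StarPresentation.
Local Open Scope group_scope.

Definition startr q (i : 'I_q) : 'S_q.+1 := tperm ord0 (lift ord0 i).

(** The relations between the transpositions (0 i).  The third one expresses
    that (0 k) commutes with (i j) = (0 i)(0 j)(0 i). *)
Definition star_relations (L : groupType) q (t : 'I_q -> L) : Prop :=
  [/\ forall i, t i * t i = 1,
      forall i j, i != j -> t i * t j * t i = t j * t i * t j
    & forall i j k, i != j -> i != k -> j != k ->
        commute (t k) (t i * t j * t i)].

Definition word_eval (L : groupType) q (t : 'I_q -> L) (w : seq 'I_q) : L :=
  \prod_(i <- w) t i.

Lemma word_eval_cat (L : groupType) q (t : 'I_q -> L) (v w : seq 'I_q) :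
  word_eval t (v ++ w) = word_eval t v * word_eval t w.
Proof. exact: big_cat. Qed.

Lemma word_eval_rcons (L : groupType) q (t : 'I_q -> L) (w : seq 'I_q) i :
  word_eval t (rcons w i) = word_eval t w * t i.
Proof. by rewrite -cats1 word_eval_cat /word_eval big_seq1. Qed.

Lemma word_eval_rev (L : groupType) q (t : 'I_q -> L) (w : seq 'I_q) :
  star_relations t -> word_eval t (rev w) = (word_eval t w)^-1.
Proof.
move=> [t2 _ _]; elim: w => [|i w IHw]; first by rewrite /word_eval !big_nil invg1.
rewrite rev_cons word_eval_rcons IHw /word_eval big_cons invgM; congr (_ * _).
by apply: (mulIg (t i)); rewrite mulVg t2.
Qed.

Lemma startr_relations q : star_relations (@startr q).
Proof.
have conj (i j : 'I_q) : i != j ->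
    startr i * startr j * startr i = tperm (lift ord0 i) (lift ord0 j).
  move=> ij; rewrite /startr -{1}(tpermV ord0 (lift ord0 i)) -mulgA -conjgE.
  by rewrite tpermJ tpermL tpermD // (inj_eq lift_inj) eq_sym.
split=> [i|i j ij|i j k ij ik jk]; first exact: tperm2.
  by rewrite conj // [RHS]conj 1?eq_sym // tpermC.
have inj := inj_eq (@lift_inj _ (@ord0 q)).
rewrite conj // /commute /startr.
apply/commgP/conjg_fixP; rewrite tpermJ !tpermD //; by rewrite inj.
Qed.

(** A permutation that fixes every leaf beyond m is one that also fixes m
    times one of the coset representatives 1, (0 m), (0 m)(0 c) with c < m.
    The reduction to this form uses the relations only, so it takes place in
    every group in which they hold. *)
Section Reduction.
Variables (L : groupType) (q : nat) (t : 'I_q -> L).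
Hypothesis trel : star_relations t.
Let ev := word_eval t.

Definition letters_below (k : nat) (w : seq 'I_q) : bool :=
  all (fun i : 'I_q => i < k)%N w.

Definition is_coset_rep (m : 'I_q) (r : seq 'I_q) : Prop :=
  [\/ r = [::], r = [:: m] | exists2 c : 'I_q, (c < m)%N & r = [:: m; c]].

Lemma coset_rep_step (m j : 'I_q) r : (j <= m)%N -> is_coset_rep m r ->
  exists h r', [/\ letters_below m h, is_coset_rep m r' &
    ev (rcons r j) = ev h * ev r'].
Proof.
have [t2 tb tc] := trel; rewrite /ev /word_eval.
have ne (a b : 'I_q) : (a < b)%N -> a != b by move=> ab; rewrite -val_eqE /= ltn_eqF.
rewrite leq_eqVlt => /predU1P[/val_inj -> | jm] [-> | -> | [c cm ->]].
- by exists [::], [:: m]; split; rewrite ?big_nil ?mul1g //; apply: Or32.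
- exists [::], [::]; split=> //; first exact: Or31.
  by rewrite /= !big_cons !big_nil !mulg1 t2.
- exists [:: c], [:: m; c]; split; rewrite /letters_below /= ?cm //.
    by apply: Or33; exists c.
  by rewrite /= !big_cons !big_nil !mulg1 !mulgA tb // eq_sym ne.
- exists [:: j], [::]; split; rewrite /letters_below /= ?jm //; first exact: Or31.
  by rewrite !big_cons !big_nil !mulg1.
- exists [::], [:: m; j]; split=> //; first by apply: Or33; exists j.
  by rewrite big_nil mul1g.
have [->|jc] := eqVneq j c.
  exists [::], [:: m]; split=> //; first exact: Or32.
  by rewrite /= !big_cons !big_nil !mulg1 mul1g t2 mulg1.
exists [:: c; j; c], [:: m; c]; split; rewrite /letters_below /= ?cm ?jm //.
  by apply: Or33; exists c.
have cjm : t m * (t c * t j * t c) = t c * t j * t c * t m.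
  by apply: tc; [rewrite eq_sym | apply: ne | apply: ne].
rewrite /= !big_cons !big_nil !mulg1.
transitivity (t c * t j * t c * t m * t c); last by rewrite !mulgA.
by rewrite -cjm -!mulgA t2 mulg1.
Qed.

Lemma word_reduction (m : 'I_q) w : letters_below m.+1 w ->
  exists h r, [/\ letters_below m h, is_coset_rep m r & ev w = ev h * ev r].
Proof.
elim/last_ind: w => [_|w j IHw].
  by exists [::], [::]; split; rewrite /ev /word_eval ?big_nil ?mulg1 //; apply: Or31.
rewrite /letters_below all_rcons => /andP[jm /IHw[h [r [hm rm evw]]]].
have [h' [r' [hm' rm' evr]]] := coset_rep_step jm rm.
exists (h ++ h'), r'; split=> //; first by rewrite /letters_below all_cat; apply/andP.
move: evw evr; rewrite /ev => evw evr.
by rewrite word_eval_cat -mulgA -evr !word_eval_rcons evw mulgA.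
Qed.

End Reduction.

Lemma star_relations_pair (G H : groupType) q (s : 'I_q -> G) (t : 'I_q -> H) :
  star_relations s -> star_relations t ->
  star_relations (fun i => (s i, t i) : G * H).
Proof.
move=> [s2 sb sc] [t2 tb tc]; split=> [i|i j ij|i j k ij ik jk].
- by congr (_, _); [apply: s2 | apply: t2].
- by congr (_, _); [apply: sb | apply: tb].
- by congr (_, _); [apply: sc | apply: tc].
Qed.

Section Presentation.
Variables (L : groupType) (q : nat) (t : 'I_q -> L).
Hypothesis trel : star_relations t.

(* Reducing in the product reduces both evaluations of a word at once. *)
Let tt (i : 'I_q) : 'S_q.+1 * L := (startr i, t i).

Let ttE w : word_eval tt w = (word_eval (@startr q) w, word_eval t w).
Proof.
elim: w => [|i w]; first by rewrite /word_eval !big_nil.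
by rewrite /word_eval !big_cons => ->.
Qed.

Let tt_relations : star_relations tt.
Proof. exact: star_relations_pair (startr_relations q) trel. Qed.

Lemma word_eval_startr_fix (m : 'I_q) w : letters_below m w ->
  word_eval (@startr q) w (lift ord0 m) = lift ord0 m.
Proof.
elim: w => [_|i w IHw /= /andP[im /IHw e]].
  by rewrite /word_eval big_nil perm1.
rewrite /word_eval big_cons permM tpermD // (inj_eq lift_inj).
by rewrite -val_eqE /= ltn_eqF.
Qed.

(** By induction on a bound for the letters.  If m is the largest letter
    allowed and the word is trivial as a permutation, its reduced form in
    S_(q+1) x L has the same representative in both components, and this
    representative is 1 because the permutation fixes the leaf m. *)
Lemma word_eval_relator w : word_eval (@startr q) w = 1 -> word_eval t w = 1.
Proof.
suff: forall k w, letters_below k w ->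
    word_eval (@startr q) w = 1 -> word_eval t w = 1.
  by apply; apply/allP => i _; apply: (ltn_ord i).
elim=> [[_ _|//]|k IHk {}w wk w1]; first by rewrite /word_eval big_nil.
have [kq|qk] := ltnP k q; last first.
  by apply: IHk w1; apply/allP => i _; apply: leq_trans (ltn_ord i) qk.
have [h [r [hk rk]]] := word_reduction tt_relations (m := Ordinal kq) wk.
(* The prefix h fixes the leaf m, so the representative r fixes it as well. *)
rewrite !ttE => -[eS eL].
have: word_eval (@startr q) r (lift ord0 (Ordinal kq)) = lift ord0 (Ordinal kq).
  by rewrite -{1}(word_eval_startr_fix hk) -permM -eS w1 perm1.
case: rk eS eL => [-> eS eL _|-> _ _|[c ck ->] _ _].
- move: eS eL; rewrite w1 /word_eval !big_nil !mulg1 => eS ->.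
  exact: IHk hk (esym eS).
- by rewrite /word_eval big_seq1 tpermR => /eqP.
- rewrite /word_eval big_cons big_seq1 permM tpermR tpermL => /lift_inj e.
  by rewrite e ltnn in ck.
Qed.

End Presentation.

Lemma star_perm_ind q (S : 'S_q.+1 -> Prop) :
  S 1 -> (forall s i, S s -> S (s * startr i)) -> forall s, S s.
Proof.
move=> S1 SM s; have : s \in <<[set tperm ord0 y | y : 'I_q.+1]>>.
  by rewrite gen_tperm inE.
case/gen_prodgP => n [c cA ->].
elim: n c cA => [|n IHn] c cA; first by rewrite big_ord0.
rewrite big_ord_recr /=.
have Sn : S (\prod_(i < n) c (widen_ord (leqnSn n) i)) by apply: IHn.
have /imsetP[y _ ->] := cA ord_max.
have [j ->|->] := unliftP ord0 y; first exact: SM.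
by rewrite tperm1 mulg1.
Qed.

(** Each permutation is sent to the value in L of any word that represents it;
    by [word_eval_relator] the choice of the word is immaterial. *)
Lemma star_presentation (L : groupType) q (t : 'I_q -> L) :
  star_relations t ->
  exists f : 'S_q.+1 -> L, {morph f : x y / x * y} /\
    forall i, f (startr i) = t i.
Proof.
move=> trel.
have word s : exists w, word_eval (@startr q) w = s.
  elim/star_perm_ind: s => [|s i [w <-]]; first by exists [::]; rewrite /word_eval big_nil.
  by exists (rcons w i); rewrite word_eval_rcons.
have wd v w : word_eval (@startr q) v = word_eval (@startr q) w ->
    word_eval t v = word_eval t w.
  move=> vw; apply: (mulIg (word_eval t (rev w))).
  rewrite [in RHS]word_eval_rev // mulgV -word_eval_cat.
  apply: word_eval_relator => //.
  by rewrite word_eval_cat word_eval_rev ?vw ?mulgV //; apply: startr_relations.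
exists (fun s => word_eval t (sval (cid (word s)))); split=> [x y|i].
  rewrite -word_eval_cat; apply: wd; rewrite word_eval_cat.
  by case: cid => z /= ->; case: cid => x' /= ->; case: cid => y' /= ->.
have -> : t i = word_eval t [:: i] by rewrite /word_eval big_seq1.
by apply: wd; case: cid => w /= ->; rewrite /word_eval big_seq1.
Qed.

End StarPresentation.

(** * Flags, ranks and automorphisms of abstract polytopes *)

(** A strictly increasing map cannot lower the rank when below each element of
    its source there are chains that descend one rank at a time.  Applied to a
    bijection and its inverse, it shows that ranks are determined by the
    order. *)
Lemma strict_homo_rank_le d d' (S : porderType d) (T : porderType d')
    (f : S -> T) (r : S -> int) (r' : T -> int) (m : int) :
  {homo f : x y / (x < y)%O} -> {homo r' : x y / (x < y)%O >-> (x < y)%R} ->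
  (forall y, m <= r' y)%R ->
  (forall x, (m < r x)%R -> exists2 y, (y < x)%O & r y = (r x - 1)%R) ->
  forall x, (r x <= r' (f x))%R.
Proof.
move=> fh r'h r'm rdown x.
have [k] : exists k : nat, (r x <= m + k%:Z)%R by exists `|r x - m|%N; lia.
elim: k x => [|k IHk] x hx; first by have := r'm (f x); lia.
have [mx|mx] := leP (r x) m; first by have := r'm (f x); lia.
have [y yx ry] := rdown x mx.
by have := IHk y; have := r'h _ _ (fh _ _ yx); lia.
Qed.

Section Flags.
Local Open Scope order_scope.
Local Open Scope classical_set_scope.
Variable P : rposet.
Implicit Types (Phi Psi : set P) (x y z : P).

Lemma smallest_flag x Phi : flag Phi -> smallest_face x -> Phi x.
Proof.
move=> [cPhi maxPhi] sx; rewrite -(maxPhi (Phi `|` [set x])); last by left.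
  by right.
move=> u v [Pu|->] [Pv|->]; first exact: cPhi.
- by right; apply: sx.
- by left; apply: sx.
- by left; apply: sx.
Qed.

Lemma largest_flag x Phi : flag Phi -> largest_face x -> Phi x.
Proof.
move=> [cPhi maxPhi] sx; rewrite -(maxPhi (Phi `|` [set x])); last by left.
  by right.
move=> u v [Pu|->] [Pv|->]; first exact: cPhi.
- by left; apply: sx.
- by right; apply: sx.
- by right; apply: sx.
Qed.

(** Zorn's lemma is applied to the sets whose union with C is a chain, a property
    that the union of the empty family satisfies as well. *)
Lemma chain_in_flag (C : set P) : chain C -> exists2 Phi, flag Phi & C `<=` Phi.
Proof.
move=> cC; have [|A [cA maxA]] :=
  @Zorn_bigcup _ [set X : set P | chain (X `|` C)].
  move=> F FP totF u v; have FC X s t : F X -> X s -> C t -> s <= t \/ t <= s.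
    by move=> /FP cX Xs Ct; apply: cX; [left | right].
  move=> [[X FX Xu]|Cu] [[Y FY Yv]|Cv]; last exact: cC.
  - have [XY|YX] := totF _ _ FX FY.
      by apply: (FP _ FY); left=> //; apply: XY.
    by apply: (FP _ FX); left=> //; apply: YX.
  - exact: FC FX Xu Cv.
  - by have [] := FC _ _ _ FY Yv Cu; [right | left].
exists (A `|` C); last by move=> x Cx; right.
split=> // Psi cPsi ACPsi.
have PC : Psi `|` C = Psi.
  by apply/seteqP; split=> [x [//|Cx]|x Psix]; [apply: ACPsi; right | left].
apply: contrapT => ne; apply: (maxA Psi); last by rewrite /= PC.
split; first by move=> x Ax; apply: ACPsi; left.
move=> PsiA; apply: ne; apply/seteqP; split=> // x /PsiA Ax; by left.
Qed.

Lemma pair_in_flag x y : x <= y -> exists Phi, [/\ flag Phi, Phi x & Phi y].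
Proof.
move=> xy; have [|Phi fPhi sub] := @chain_in_flag [set x; y].
  by move=> u v [->|->] [->|->]; rewrite ?lexx ?xy; auto.
by exists Phi; split=> //; apply: sub; [left | right].
Qed.

Lemma face_in_flag x : exists2 Phi, flag Phi & Phi x.
Proof. by have [Phi [? ? _]] := pair_in_flag (lexx x); exists Phi. Qed.

Lemma pautM_app (g h : paut P) x : (g * h)%g x = h (g x). Proof. by []. Qed.
Lemma paut1_app x : (1%g : paut P) x = x. Proof. by []. Qed.
Lemma pautKV (g : paut P) : cancel g (g^-1)%g. Proof. exact: paut_funK. Qed.
Lemma pautVK (g : paut P) : cancel (g^-1)%g g. Proof. exact: paut_invK. Qed.

Lemma paut_le (g : paut P) x y : (g x <= g y) = (x <= y).
Proof.
apply/idP/idP; last exact: paut_fun_homo.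
by move=> /(paut_fun_homo g^-1%g); rewrite !pautKV.
Qed.

Lemma paut_lt (g : paut P) x y : (g x < g y) = (x < y).
Proof. by rewrite !lt_neqAle paut_le (can_eq (pautKV g)). Qed.

Lemma paut_smallest (g : paut P) z : smallest_face z -> g z = z.
Proof.
by move=> sz; apply/le_anti; rewrite sz -{2}(pautVK g z) paut_le sz.
Qed.

Lemma paut_largest (g : paut P) z : largest_face z -> g z = z.
Proof.
by move=> sz; apply/le_anti; rewrite sz -{1}(pautVK g z) paut_le sz.
Qed.

End Flags.

Section GradedPosets.
Local Open Scope order_scope.

(** The part of the axioms of a polytope that makes the rank an invariant of
    the order. *)
Record graded (F : rposet) : Prop := {
  graded_homo : {homo @rank F : x y / x < y >-> (x < y)%R};
  graded_ge : forall x : F, (-1 <= rank x)%R;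
  graded_down : forall x : F, (-1 < rank x)%R ->
    exists2 y, y < x & rank y = (rank x - 1)%R }.

Lemma graded_paut_rank (F : rposet) (gF : graded F) (g : paut F) x :
  rank (g x) = rank x.
Proof.
have le (h : paut F) y : (rank y <= rank (h y))%R.
  apply: (strict_homo_rank_le (m := -1) (f := h)) => //.
  - by move=> u v; rewrite paut_lt.
  - exact: graded_homo gF.
  - exact: graded_ge gF.
  - exact: graded_down gF.
by apply/eqP; rewrite eq_le le andbT -{2}(pautKV g x) le.
Qed.

End GradedPosets.

Section RankedPosets.
Local Open Scope order_scope.
Local Open Scope classical_set_scope.

(** The part of the axioms of a polytope that the study of chains needs; it is
    separated so that it can serve in proofs that a poset is a polytope. *)
Record ranked (n : nat) (P : rposet) : Prop := {
  ranked_mono : {homo @rank P : x y / x < y >-> (x < y)%R};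
  rank_bounds : forall x : P, (-1 <= rank x <= n%:Z)%R }.

Lemma polytope_ranked n P : polytope n P -> ranked n P.
Proof.
move=> hP; split; first exact: rank_mono hP.
move=> x; have : range (@rank P) (rank x) by exists x.
by rewrite (rank_range hP).
Qed.

Coercion polytope_ranked : polytope >-> ranked.

Variables (n : nat) (P : rposet).
Hypothesis hP : ranked n P.
Implicit Types (Phi Psi : set P) (x y z : P) (i j : int).

Lemma rank_homo x y : x <= y -> (rank x <= rank y)%R.
Proof.
by rewrite le_eqVlt => /predU1P[->//|/(ranked_mono hP)]; apply: ltW.
Qed.

Lemma le_rank_eq x y : x <= y -> rank x = rank y -> x = y.
Proof.
rewrite le_eqVlt => /predU1P[->//|/(ranked_mono hP)] /[swap] ->.
by rewrite ltxx.
Qed.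

Lemma chain_rank_inj Phi x y :
  chain Phi -> Phi x -> Phi y -> rank x = rank y -> x = y.
Proof.
move=> cPhi Px Py e; have [/le_rank_eq|/le_rank_eq] := cPhi x y Px Py; first exact.
by move=> /(_ (esym e)).
Qed.

Lemma chain_rank_le Phi x y :
  chain Phi -> Phi x -> Phi y -> (rank x <= rank y)%R -> x <= y.
Proof.
move=> cPhi Px Py e; have [//|yx] := cPhi x y Px Py.
rewrite (@chain_rank_inj Phi x y) //.
by have := rank_homo yx; lia.
Qed.

Lemma full_chain_flag Phi : chain Phi ->
  (forall i, (-1 <= i <= n%:Z)%R -> exists2 x, Phi x & rank x = i) -> flag Phi.
Proof.
move=> cPhi full; split=> // Psi cPsi PhiPsi; apply/seteqP; split=> // x Psix.
have [y Phiy ry] := full _ (rank_bounds hP x).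
by rewrite (chain_rank_inj cPsi Psix (PhiPsi _ Phiy) (esym ry)).
Qed.

(** If a flag had no face of rank i, a face of rank i between its closest faces
    below and above would be comparable with the whole flag. *)
Lemma dense_flag_full (lo hi : P) : smallest_face lo -> largest_face hi ->
  rank lo = (-1)%R -> rank hi = (n%:Z)%R ->
  (forall x y i, x <= y -> (rank x < i < rank y)%R ->
     exists2 z, x <= z <= y & rank z = i) ->
  forall Phi, flag Phi -> forall i, (-1 <= i <= n%:Z)%R ->
  exists2 x, Phi x & rank x = i.
Proof.
move=> slo lhi rlo rhi dense Phi fPhi i in_i; have [cPhi _] := fPhi.
have Plo : Phi lo := smallest_flag fPhi slo.
have Phi_hi : Phi hi := largest_flag fPhi lhi.
apply: contrapT => none.
have ne x : Phi x -> rank x <> i by move=> Px rx; apply: none; exists x.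
(* Distances to i of the ranks of the faces of Phi, so as to pick the closest. *)
pose below (d : nat) := `[< exists2 x, Phi x & rank x = (i - 1 - d%:Z)%R >].
pose above (d : nat) := `[< exists2 x, Phi x & rank x = (i + 1 + d%:Z)%R >].
have exb : exists d, below d.
  by have := ne _ Plo; exists (absz (i - 1 - rank lo)%R); apply/asboolP; exists lo => //; lia.
have exa : exists d, above d.
  by have := ne _ Phi_hi; exists (absz (rank hi - i - 1)%R); apply/asboolP; exists hi => //; lia.
case: (ex_minnP exb) => d /asboolP[x Px rx] mind.
case: (ex_minnP exa) => e /asboolP[y Py ry] mine.
have xmax w : Phi w -> (rank w < i)%R -> w <= x.
  move=> Pw rw; apply: (chain_rank_le cPhi) => //.
  suff : (d <= absz (i - 1 - rank w)%R)%N by lia.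
  by apply: mind; apply/asboolP; exists w => //; lia.
have ymin w : Phi w -> (i < rank w)%R -> y <= w.
  move=> Pw rw; apply: (chain_rank_le cPhi) => //.
  suff : (e <= absz (rank w - i - 1)%R)%N by lia.
  by apply: mine; apply/asboolP; exists w => //; lia.
have xy : x <= y by apply: (chain_rank_le cPhi) => //; lia.
have [|z /andP[xz zy] rz] := dense x y i xy; first by lia.
apply: none; exists z => //.
rewrite -(fPhi.2 (Phi `|` [set z])); [by right| |by move=> w; left].
have comp w : Phi w -> w <= z \/ z <= w.
  move=> Pw; have := ne w Pw; case: (ltgtP (rank w) i) => // rw _.
    by left; apply: le_trans xz; apply: xmax.
  by right; apply: le_trans zy _; apply: ymin.
move=> u v [Pu|->] [Pv|->]; [exact: cPhi|exact: comp| |by left].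
by have [] := comp v Pv; [right|left].
Qed.

End RankedPosets.

Section Faces.
Local Open Scope order_scope.
Local Open Scope classical_set_scope.
Variables (n : nat) (P : rposet).
Hypothesis hP : polytope n P.
Implicit Types (Phi Psi : set P) (x y z : P) (i j : int) (g h : paut P).

Lemma flag_face Phi i : flag Phi -> (-1 <= i <= n%:Z)%R ->
  exists2 x, Phi x & rank x = i.
Proof. by move=> fPhi /(flag_ranks hP fPhi)[x [[Px rx] _]]; exists x. Qed.

Lemma flag_ext Phi Psi : flag Phi -> chain Psi -> Phi `<=` Psi -> Phi = Psi.
Proof. by move=> [_ m] cPsi /(m _ cPsi). Qed.

Lemma face_between x y i : x <= y -> (rank x <= i <= rank y)%R ->
  exists2 z, x <= z <= y & rank z = i.
Proof.
move=> xy ixy; have [Phi [fPhi Px Py]] := pair_in_flag xy.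
have [|z Pz rz] := @flag_face Phi i fPhi.
  by have := (rank_bounds hP x, rank_bounds hP y) => -[]; lia.
exists z => //; apply/andP; split.
  by apply: (chain_rank_le hP) (fPhi.1) _ _ _ => //; lia.
by apply: (chain_rank_le hP) (fPhi.1) _ _ _ => //; lia.
Qed.

Lemma rank_smallest x : smallest_face x -> rank x = (-1)%R.
Proof.
move=> sx; have : range (@rank P) (-1)%R by rewrite (rank_range hP) /=; lia.
by case=> y _ ry; have := rank_homo hP (sx y); have := rank_bounds hP x; lia.
Qed.

Lemma rank_largest x : largest_face x -> rank x = (n%:Z)%R.
Proof.
move=> sx; have : range (@rank P) (n%:Z)%R by rewrite (rank_range hP) /=; lia.
by case=> y _ ry; have := rank_homo hP (sx y); have := rank_bounds hP x; lia.
Qed.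

Lemma smallest_rank x : rank x = (-1)%R -> smallest_face x.
Proof.
move=> rx; have [y sy] := ex_smallest hP.
suff <- : y = x by [].
by apply: (le_rank_eq hP) => //; rewrite rx rank_smallest.
Qed.

Lemma largest_rank x : rank x = (n%:Z)%R -> largest_face x.
Proof.
move=> rx; have [y sy] := ex_largest hP.
suff -> : x = y by [].
by apply: (le_rank_eq hP) => //; rewrite rx rank_largest.
Qed.

Lemma rank_down x : (-1 < rank x)%R ->
  exists2 y, y < x & rank y = (rank x - 1)%R.
Proof.
move=> rx; have [b sb] := ex_smallest hP.
have [|y /andP[_ yx] ry] := @face_between b x (rank x - 1)%R (sb x).
  by rewrite (rank_smallest sb); lia.
exists y => //; rewrite lt_neqAle yx andbT; apply: contra_eqN ry => /eqP ->.
by lia.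
Qed.

Lemma polytope_graded : graded P.
Proof.
split; [exact: rank_mono hP | | exact: rank_down].
by move=> x; have := rank_bounds hP x; lia.
Qed.

Lemma paut_rank g x : rank (g x) = rank x.
Proof. exact: graded_paut_rank polytope_graded g x. Qed.

Lemma image_flag g Phi : flag Phi -> flag [set g x | x in Phi].
Proof.
move=> fPhi; apply: (full_chain_flag hP).
  move=> _ _ [x Px <-] [y Py <-]; rewrite !paut_le; exact: fPhi.1.
move=> i /(flag_face fPhi)[x Px rx]; exists (g x); last by rewrite paut_rank.
by exists x.
Qed.

Lemma image_eq_app g h Phi x : flag Phi ->
  [set g y | y in Phi] = [set h y | y in Phi] -> Phi x -> g x = h x.
Proof.
move=> fPhi e Px; apply: (chain_rank_inj hP (image_flag h fPhi).1).
- by rewrite -e; exists x.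
- by exists x.
- by rewrite !paut_rank.
Qed.

(** Two faces between x and y that both differ from a third one coincide, as there
    are only two. *)
Lemma diamond_unique j x y z1 z2 z3 :
  rank x = (j - 1)%R -> rank y = (j + 1)%R ->
  x <= z1 <= y -> x <= z2 <= y -> x <= z3 <= y ->
  rank z1 = j -> rank z2 = j -> rank z3 = j ->
  z1 <> z3 -> z2 <> z3 -> z1 = z2.
Proof.
move=> rx ry xz1 xz2 xz3 r1 r2 r3 n13 n23.
have xy : x <= y by case/andP: xz1; apply: le_trans.
have [a [b [ab D]]] := diamond hP xy rx ry.
have mem z : rank z = j -> x <= z <= y -> z = a \/ z = b.
  by move=> rz xz; have : [set a; b] z by rewrite -D.
have [e1|e1] := mem _ r1 xz1; have [e2|e2] := mem _ r2 xz2;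
  have [e3|e3] := mem _ r3 xz3; by rewrite ?e1 ?e2 ?e3 in n13 n23 *.
Qed.

Lemma adjacent_faces j Phi Psi : flag Phi -> flag Psi -> adjacent_at j Phi Psi ->
  exists x y w z, [/\ [/\ Phi x, Phi y, Psi x & Psi y],
    Phi w /\ Psi z, [/\ rank x = (j - 1)%R, rank y = (j + 1)%R, rank w = j & rank z = j],
    x <= w <= y /\ x <= z <= y & w <> z].
Proof.
move=> fPhi fPsi [ne ag].
have eqP_ : (forall u, rank u = j -> (Phi u <-> Psi u)) -> False.
  move=> agj; apply: ne; apply/seteqP; split=> u.
    by have [/agj[]|/ag[]] := pselect (rank u = j).
  by have [/agj[]|/ag[]] := pselect (rank u = j).
have jl : (-1 < j)%R.
  rewrite ltNge; apply/negP => jl; apply: eqP_ => u ru.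
  have su : smallest_face u by apply: smallest_rank; have := rank_bounds hP u; lia.
  by split=> _; apply: smallest_flag.
have jn : (j < n%:Z)%R.
  rewrite ltNge; apply/negP => jn; apply: eqP_ => u ru.
  have su : largest_face u by apply: largest_rank; have := rank_bounds hP u; lia.
  by split=> _; apply: largest_flag.
have [|x Px rx] := @flag_face Phi (j - 1)%R fPhi; first by lia.
have [|y Py ry] := @flag_face Phi (j + 1)%R fPhi; first by lia.
have [|w Pw rw] := @flag_face Phi j fPhi; first by lia.
have [|z Pz rz] := @flag_face Psi j fPsi; first by lia.
have Qx : Psi x by apply/ag => //; lia.
have Qy : Psi y by apply/ag => //; lia.
have [cPhi _] := fPhi; have [cPsi _] := fPsi.
exists x, y, w, z; split=> //.
  have lePhi u v : Phi u -> Phi v -> (rank u <= rank v)%R -> u <= v.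
    exact: (chain_rank_le hP).
  have lePsi u v : Psi u -> Psi v -> (rank u <= rank v)%R -> u <= v.
    exact: (chain_rank_le hP).
  split; apply/andP; split; [apply: lePhi|apply: lePhi|apply: lePsi|apply: lePsi];
    by [|lia].
move=> wz; apply: eqP_ => u ru; split=> Hu.
  by rewrite (chain_rank_inj hP cPhi Hu Pw) ?ru // wz.
by rewrite (chain_rank_inj hP cPsi Hu Pz) ?ru // -wz.
Qed.

Lemma adjacent_unique j Phi Psi1 Psi2 :
  flag Phi -> flag Psi1 -> flag Psi2 ->
  adjacent_at j Phi Psi1 -> adjacent_at j Phi Psi2 -> Psi1 = Psi2.
Proof.
move=> fPhi f1 f2 a1 a2.
have [x [y [w [z1 [[Px Py _ _] [Pw Q1] [rx ry rw rz1] [xw xz1] wz1]]]]] :=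
  adjacent_faces fPhi f1 a1.
have [x' [y' [w' [z2 [[Px' Py' _ _] [Pw' Q2] [rx' ry' rw' rz2] [_ xz2] wz2]]]]] :=
  adjacent_faces fPhi f2 a2.
have [cPhi _] := fPhi.
have ex : x' = x by apply: (chain_rank_inj hP) cPhi _ _ _ => //; rewrite rx.
have ey : y' = y by apply: (chain_rank_inj hP) cPhi _ _ _ => //; rewrite ry.
have ew : w' = w by apply: (chain_rank_inj hP) cPhi _ _ _ => //; rewrite rw.
subst x' y' w'.
have z12 : z1 = z2.
  by apply: (diamond_unique rx ry xz1 xz2 xw rz1 rz2 rw) => /esym.
apply: flag_ext => //; first exact: f2.1.
move=> u Q1u; have [ru|ru] := pselect (rank u = j).
  by rewrite (chain_rank_inj hP f1.1 Q1u Q1) ?z12 // ru.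
by apply/(a2.2 _ ru)/(a1.2 _ ru).
Qed.

Lemma flag_joined_ind (S : set P -> Prop) Phi Psi : flag Phi -> flag Psi ->
  S Phi ->
  (forall F G j, flag F -> flag G -> Phi `&` Psi `<=` F -> Phi `&` Psi `<=` G ->
     adjacent_at j F G -> S F -> S G) ->
  S Psi.
Proof.
move=> fPhi fPsi S0 SS; have [k [c [c0 ck cf ca]]] := flag_connected hP fPhi fPsi.
suff H (i : nat) : (i <= k)%N -> S (c i) by rewrite -ck; apply: H.
elim: i => [|i IHi] ik; first by rewrite c0.
have [j a] := ca _ ik; have [f1 s1] := cf _ (ltnW ik); have [f2 s2] := cf _ ik.
exact: SS a (IHi (ltnW ik)).
Qed.

(** The property of being fixed facewise passes from a flag to an adjacent one by
    the diamond condition, hence to all flags by connectivity. *)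
Lemma paut_rigid g Phi : flag Phi -> (forall x, Phi x -> g x = x) -> g = 1%g.
Proof.
move=> fPhi fix_Phi; apply: pautP => x; rewrite paut1_app.
have [Psi fPsi Px] := face_in_flag x.
move: x Px; pose fixes (F : set P) := forall x, F x -> g x = x.
apply: (flag_joined_ind (S := fixes) fPhi fPsi) => // F G j fF fG _ _ a fixF x Gx.
have [u [v [w [z [[Fu Fv Gu Gv] [Fw Gz] [ru rv rw rz] [uw uz] wz]]]]] :=
  adjacent_faces fF fG a.
have [rx|rx] := pselect (rank x = j); last by apply: fixF; apply/(a.2 x rx).
have -> : x = z by apply: (chain_rank_inj hP) fG.1 _ _ _ => //; rewrite rx.
apply: (@diamond_unique j u v _ _ w) => //; rewrite ?paut_rank //.
- by rewrite -{1}(fixF u Fu) -{1}(fixF v Fv) !paut_le.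
- by rewrite -{1}(fixF w Fw) => /(can_inj (pautKV g)) /esym.
- by move=> /esym.
Qed.

Lemma paut_eq_flag g h Phi : flag Phi -> (forall x, Phi x -> g x = h x) -> g = h.
Proof.
move=> fPhi gh; apply/(mulIg h^-1%g); rewrite mulgV.
by apply: (paut_rigid fPhi) => x Px; rewrite pautM_app gh // pautKV.
Qed.

(** The stabilizer of a face x of the base flag is generated by the generators
    whose rank is not that of x.  If h fixes x, the base flag and its image
    under h are joined by flags that contain x; each of them is the image of
    the base flag under a product of generators, and the next step multiplies
    that product on the left by one more generator. *)
Lemma stabilizer_ind Phi (rho : 'I_n -> paut P) x (S : paut P -> Prop) :
  flag Phi -> Phi x -> distinguished_generators Phi rho ->
  S 1%g -> (forall (j : 'I_n) h, rank x <> (j%:Z)%R -> S h -> S (rho j * h)%g) ->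
  forall h, h x = x -> S h.
Proof.
move=> fPhi Px drho S1 SM h hx.
pose T Psi := exists g, [/\ S g, g x = x & [set g y | y in Phi] = Psi].
have hPhi : flag [set h y | y in Phi] := image_flag h fPhi.
suff [g [Sg _ /image_eq_app e]] : T [set h y | y in Phi].
  by rewrite -(@paut_eq_flag g h Phi) // => y Py; apply: e.
apply: (flag_joined_ind (S := T) fPhi hPhi).
  exists 1%g; split=> //; apply/seteqP; split=> [_ [y Py <-] //|y Py].
  by exists y.
move=> F G j fF fG sF sG a [g [Sg gx gF]].
have xPhi : (Phi `&` [set h y | y in Phi]) x by split=> //; exists x.
have [u [v [w [z [_ [Fw Gz] [ru rv rw rz] [uw uz] wz]]]]] := adjacent_faces fF fG a.
have xj : rank x <> j.
  move=> xj; apply: wz; rewrite (chain_rank_inj hP fF.1 Fw (sF _ xPhi)) ?xj //.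
  by rewrite (chain_rank_inj hP fG.1 Gz (sG _ xPhi)) ?xj.
have jn : (0 <= j < n%:Z)%R by have := (rank_bounds hP u, rank_bounds hP v) => -[]; lia.
have jn' : (`|j|%N < n)%N by lia.
pose k := Ordinal jn'; have kj : (k%:Z)%R = j by rewrite /=; lia.
(* Pull the step from F to G back to the base flag by g. *)
have a' : adjacent_at j Phi [set (g^-1)%g y | y in G].
  have [ne ag] := a; split.
    move=> e; apply: ne; rewrite -gF e.
    apply/seteqP; split=> [_ [_ [y Gy <-] <-]|y Gy]; rewrite ?pautVK //.
    by exists ((g^-1)%g y); rewrite ?pautVK //; exists y.
  move=> y ry; split=> [Py|[y' Gy' ey]].
    exists (g y); last by rewrite pautKV.
    by apply/ag; rewrite ?paut_rank // -gF; exists y.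
  have ry' : rank y' <> j by rewrite -(paut_rank (g^-1)%g) ey.
  rewrite -ey; have : F y' by apply/(ag _ ry').
  by rewrite -gF => -[y'' Py'' <-]; rewrite pautKV.
have dk := drho k; rewrite kj in dk.
have fG' := image_flag (g^-1)%g fG; have fk := image_flag (rho k) fPhi.
have ek := adjacent_unique fPhi fG' fk a' dk.
exists (rho k * g)%g; split.
- by apply: SM => //; rewrite kj.
- rewrite pautM_app; suff -> : rho k x = x by [].
  apply: (chain_rank_inj hP fPhi.1) => //; last exact: paut_rank.
  by apply/(dk.2 _); [rewrite paut_rank | exists x].
apply/seteqP; split=> [_ [y Py <-]|y Gy].
  have : [set rho k y | y in Phi] (rho k y) by exists y.
  by rewrite -ek pautM_app => -[y' Gy' <-]; rewrite pautVK.
have : [set (g^-1)%g y | y in G] (g^-1 y)%g by exists y.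
rewrite ek => -[y' Py' e]; exists y' => //.
by rewrite pautM_app e pautVK.
Qed.

End Faces.

(** * Quotients from morphisms that preserve generators *)

Section Multiplicative.
Local Open Scope group_scope.

Lemma multiplicative1 (G H : groupType) (f : G -> H) :
  {morph f : x y / x * y} -> f 1 = 1.
Proof. by move=> fM; apply: (mulgI (f 1)); rewrite mulg1 -fM mulg1. Qed.

Lemma multiplicativeV (G H : groupType) (f : G -> H) :
  {morph f : x y / x * y} -> {morph f : x / x^-1}.
Proof.
move=> fM x; apply: (mulgI (f x)).
by rewrite mulgV -fM mulgV multiplicative1.
Qed.

Lemma multiplicative_exists (G H : groupType) (f : G -> H) :
  {morph f : x y / x * y} -> exists F : {multiplicative G -> H}, F =1 f.
Proof.
move=> fM; pose m := isMultiplicative.Build G H f fM.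
pose F : {multiplicative G -> H} := HB.pack f m.
by exists F.
Qed.

End Multiplicative.

Section Quotient.
Local Open Scope order_scope.
Local Open Scope classical_set_scope.
Variables (n : nat) (P Q : rposet) (f : paut P -> paut Q).
Variables (Phi : set P) (Psi : set Q) (rho : 'I_n -> paut P).
Hypothesis fM : {morph f : g h / (g * h)%g}.
Hypotheses (regP : regular_polytope n P) (regQ : regular_polytope n Q).
Hypotheses (fPhi : flag Phi) (fPsi : flag Psi).
Hypothesis rhoP : distinguished_generators Phi rho.
Hypothesis rhoQ : distinguished_generators Psi (f \o rho).

Let hP := regP.1.
Let hQ := regQ.1.

Let f1 : f 1%g = 1%g := multiplicative1 fM.
Let fV : {morph f : g / g^-1%g} := multiplicativeV fM.

Lemma generators_fix m (R : rposet) (hR : polytope m R) (F : set R) (r : 'I_m -> paut R) x :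
  flag F -> F x -> distinguished_generators F r ->
  forall j : 'I_m, rank x <> (j%:Z)%R -> r j x = x.
Proof.
move=> fF Fx dr j xj; apply: (chain_rank_inj hR fF.1) => //; last exact: (paut_rank hR).
by apply/((dr j).2 _); [rewrite (paut_rank hR) | exists x].
Qed.

(** On the stabilizer generated by the rho j with j different from the rank of x,
    the property passes from each factor to the product. *)
Lemma stabilizer_image x y (h : paut P) : Phi x -> Psi y -> rank x = rank y ->
  h x = x -> f h y = y.
Proof.
move=> Px Py xy; move: h; apply: (stabilizer_ind hP fPhi Px rhoP).
  by rewrite f1.
move=> j h xj IHh; rewrite fM pautM_app.
by rewrite (generators_fix hQ fPsi Py rhoQ) // -xy.
Qed.

Lemma stabilizer_lift x y (h : paut Q) : Phi x -> Psi y -> rank x = rank y ->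
  h y = y -> exists2 g : paut P, g x = x & f g = h.
Proof.
move=> Px Py xy; move: h; apply: (stabilizer_ind hQ fPsi Py rhoQ).
  by exists 1%g.
move=> j h yj [g gx <-]; exists (rho j * g)%g; last by rewrite fM.
by rewrite pautM_app (generators_fix hP fPhi Px rhoP) // xy.
Qed.

Lemma morphism_onto h : exists g, f g = h.
Proof.
have [|x Px rx] := @flag_face _ _ hP Phi (-1)%R fPhi; first by lia.
have [|y Py ry] := @flag_face _ _ hQ Psi (-1)%R fPsi; first by lia.
have hy : h y = y by exact: paut_smallest (smallest_rank hQ ry).
have [|g _ <-] := stabilizer_lift Px Py _ hy; first by rewrite rx.
by exists g.
Qed.

Lemma face_image m (R : rposet) (regR : regular_polytope m R) (F : set R) x :
  flag F -> exists (g : paut R) y, F y /\ x = g y.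
Proof.
move=> fF; have [G fG Gx] := face_in_flag x.
have [g e] := regR.2 F G fF fG; move: Gx; rewrite -e => -[y Fy <-].
by exists g, y.
Qed.

(* The graph of the covering map that sends g a, for a face a of Phi, to f g b,
   where b is the face of Psi of the rank of a. *)
Let cover (x : P) (u : Q) := exists (g : paut P) a b,
  [/\ Phi a, Psi b, rank a = rank b, x = g a & u = f g b].

Let coverP x : exists u, cover x u.
Proof.
have [g [a [Pa ->]]] := face_image regP x fPhi.
have [|b Pb rb] := @flag_face _ _ hQ Psi (rank a) fPsi.
  exact: rank_bounds hP a.
by exists (f g b), g, a, b; split.
Qed.

Let coverQ u : exists x, cover x u.
Proof.
have [h [b [Pb ->]]] := face_image regQ u fPsi.
have [|a Pa ra] := @flag_face _ _ hP Phi (rank b) fPhi.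
  exact: rank_bounds hQ b.
by have [g <-] := morphism_onto h; exists (g a), g, a, b; split.
Qed.

Let cover_fun x u v : cover x u -> cover x v -> u = v.
Proof.
move=> [g [a [b [Pa Pb ab -> ->]]]] [g' [a' [b' [Pa' Pb' ab' e ->]]]].
have aa : a = a'.
  apply: (chain_rank_inj hP fPhi.1) => //.
  by rewrite -(paut_rank hP g) e (paut_rank hP).
subst a'; have bb : b' = b.
  by apply: (chain_rank_inj hQ fPsi.1) => //; rewrite -ab' ab.
subst b'; have : f (g * g'^-1)%g b = b.
  by apply: (stabilizer_image Pa) => //; rewrite pautM_app e pautKV.
rewrite fM fV pautM_app => e'.
by rewrite -[LHS](pautVK (f g')) e'.
Qed.

Let cover_move x u (g : paut P) : cover x u -> cover (g x) (f g u).
Proof.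
move=> [h [a [b [Pa Pb ab -> ->]]]]; exists (h * g)%g, a, b; split=> //.
by rewrite fM.
Qed.

Let cover_fiber x y u : cover x u -> cover y u -> exists2 g : paut P, f g = 1%g & y = g x.
Proof.
move=> [g [a [b [Pa Pb ab -> ->]]]] [g' [a' [b' [Pa' Pb' ab' -> e]]]].
have bb : b' = b.
  apply: (chain_rank_inj hQ fPsi.1) => //.
  by rewrite -(paut_rank hQ (f g')) -e (paut_rank hQ).
subst b'; have aa : a' = a.
  by apply: (chain_rank_inj hP fPhi.1) => //; rewrite ab.
subst a'; have [|k ka fk] := @stabilizer_lift a b (f g * (f g')^-1)%g Pa Pb ab.
  by rewrite pautM_app e pautKV.
exists (g^-1 * k * g')%g; last by rewrite !pautM_app pautKV ka.
by rewrite !fM fV fk !mulgA mulVg mul1g mulVg.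
Qed.

(** The faces of Q are the orbits of the kernel of f, as the fibres of the covering
    map.  Comparable faces lie in a common flag, and flags can be carried to the
    base flags on both sides, so comparability lifts. *)
Lemma quotient_of_morphism : is_quotient P Q.
Proof.
pose N : {pred paut P} := [pred g | `[< f g = 1%g >]].
have inN g : (g \in N) = `[< f g = 1%g >] by [].
exists N; split.
  split; first by rewrite inN; apply/asboolP.
  move=> g h; rewrite !inN => /asboolP fg /asboolP fh; apply/asboolP.
  by rewrite fM fV fg fh divgg.
have orbitE x u : cover x u -> paut_orbit N x = [set y | cover y u].
  move=> xu; apply/seteqP; split=> [_ [g /= Ng <-]|y yu].
    by move: Ng => /asboolP fg; have := cover_move g xu; rewrite fg.
  have [g fg ->] := cover_fiber xu yu; exists g => //=.
  exact/asboolP.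
exists (fun u => [set x | cover x u]); split.
  split.
  - move=> u _; have [x xu] := coverQ u; exists x => //; exact: orbitE.
  - move=> u v _ _ e; have [x xu] := coverQ u.
    have : [set x | cover x u] x by [].
    by rewrite e /=; apply: cover_fun.
  - move=> _ [x _ <-]; have [u xu] := coverP x.
    by exists u => //; rewrite (orbitE _ _ xu).
move=> u v; split=> [uv|[x [y [xu yv xy]]]].
  have [G [fG Gu Gv]] := pair_in_flag uv.
  have [h hG] := regQ.2 _ _ fPsi fG; move: Gu Gv; rewrite -hG.
  move=> [b Pb bu] [b' Pb' bv]; have [g gh] := morphism_onto h.
  have [|a Pa ra] := @flag_face _ _ hP Phi (rank b) fPhi; first exact: rank_bounds hQ b.
  have [|a' Pa' ra'] := @flag_face _ _ hP Phi (rank b') fPhi; first exact: rank_bounds hQ b'.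
  exists (g a), (g a'); split=> /=.
  - by exists g, a, b; rewrite gh bu.
  - by exists g, a', b'; rewrite gh bv.
  - rewrite paut_le; apply: (chain_rank_le hP fPhi.1) => //.
    by rewrite ra ra'; apply: (rank_homo hQ); rewrite -(paut_le h) bu bv.
have [G [fG Gx Gy]] := pair_in_flag xy.
have [g gG] := regP.2 _ _ fPhi fG; move: Gx Gy; rewrite -gG.
move=> [a Pa ax] [a' Pa' ay].
have [|b Pb rb] := @flag_face _ _ hQ Psi (rank a) fPsi; first exact: rank_bounds hP a.
have [|b' Pb' rb'] := @flag_face _ _ hQ Psi (rank a') fPsi; first exact: rank_bounds hP a'.
have -> : u = f g b by apply: cover_fun xu _; exists g, a, b.
have -> : v = f g b' by apply: cover_fun yv _; exists g, a', b'.
rewrite paut_le; apply: (chain_rank_le hQ fPsi.1) => //.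
by rewrite rb rb'; apply: (rank_homo hP); rewrite -(paut_le g) ax ay.
Qed.

End Quotient.

(** * Extending automorphisms of sections *)

Section SectionEmbedding.
Local Open Scope order_scope.
Local Open Scope classical_set_scope.

(** An identification of F with the section from x to y of Q, as a map into Q
    rather than into the subtype of the section. *)
Record section_embedding (Q F : rposet) (x y : Q) (iota : F -> Q) : Prop := {
  embedding_le : {mono iota : u v / u <= v};
  embedding_image : forall z, x <= z <= y <-> exists u, z = iota u;
  embedding_rank : forall u, rank (iota u) = (rank u + rank x + 1)%R }.

(** The rank condition is automatic: [strict_homo_rank_le] applies to the
    isomorphism in both directions. *)
Lemma section_embedding_exists n (Q F : rposet) (x y : Q) :
  polytope n Q -> graded F -> poset_iso (psection x y) F ->
  exists iota, @section_embedding Q F x y iota.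
Proof.
move=> hQ gF [e [[e' eK e'K] emono]].
have e'mono : {mono e' : u v / u <= v} by move=> u v; rewrite -emono !e'K.
exists (fun u => val (e' u)); split.
- by move=> u v; rewrite -e'mono.
- move=> z; split=> [xz|[u ->]]; last exact: (valP (e' u)).
  by exists (e (exist _ z xz)); rewrite eK.
have sl (u v : psection x y) : (u < v) = (val u < val v) by [].
have e'lt : {homo e' : u v / u < v}.
  by move=> u v; rewrite !lt_neqAle e'mono (can_eq e'K).
have elt : {homo e : u v / u < v}.
  by move=> u v; rewrite !lt_neqAle emono (can_eq eK).
pose r (z : psection x y) := (rank (val z : Q) - rank x - 1)%R.
have le1 u : (rank u <= r (e' u))%R.
  apply: (strict_homo_rank_le (m := -1) (f := e')) => //.
  - by move=> z w; rewrite sl /r => /(rank_mono hQ); lia.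
  - move=> z; have /andP[xz _] := valP z; move: (rank_homo hQ xz).
    by rewrite /r; set a := rank x; set b := rank _; lia.
  - exact: graded_down gF.
have le2 z : (r z <= rank (e z))%R.
  apply: (strict_homo_rank_le (m := -1) (f := e)) => //.
  - exact: graded_homo gF.
  - exact: graded_ge gF.
  move=> w rw; have /andP[xw wy] := valP w; rewrite /r in rw.
  have [|v /andP[xv vw] rv] := @face_between _ _ hQ x (val w) (rank (val w) - 1)%R xw.
    by move: rw; set a := rank x; set b := rank _; lia.
  have xvy : x <= v <= y by rewrite xv (le_trans vw wy).
  exists (exist _ v xvy); last by rewrite /r /= rv; set a := rank x; set b := rank _; lia.
  rewrite sl /= lt_neqAle vw andbT; apply: contra_eqN rv => /eqP ->.
  by set a := rank _; lia.
move=> u; have := le1 u; have := le2 (e' u); rewrite e'K /r.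
by set a := rank x; set b := rank _; set c := rank u; lia.
Qed.

(* The hypothesis [outside] holds for the facets, where only the largest face of
   Q is missed, and for the vertex-figures, where only the smallest one is.
   Every automorphism of Q fixes these two faces. *)
Variables (n : nat) (Q F : rposet) (x y : Q) (iota : F -> Q) (Psi : set Q).
Hypotheses (gF : graded F) (emb : section_embedding x y iota).
Hypothesis fPsi : flag Psi.
Hypothesis outside : forall z, Psi z ->
  [\/ exists u, z = iota u, smallest_face z | largest_face z].

Let iota_inj : injective iota.
Proof.
by move=> u v e; apply/le_anti; rewrite -!(embedding_le emb) e lexx.
Qed.

Lemma preimage_flag : flag [set u | Psi (iota u)].
Proof.
split; first by move=> u v Pu Pv; rewrite -!(embedding_le emb); apply: fPsi.1.
move=> H cH sub; apply/seteqP; split=> // u Hu /=.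
rewrite -(fPsi.2 (Psi `|` [set iota u])); [by right| |by move=> z; left].
have comp z : Psi z -> z <= iota u \/ iota u <= z.
  move=> Pz; have [[v zv]|sz|lz] := outside Pz; [|by left; apply: sz|by right; apply: lz].
  by rewrite zv !(embedding_le emb); apply: cH => //; apply: sub; rewrite /= -zv.
move=> z w [Pz|->] [Pw|->]; [exact: fPsi.1|exact: comp| |by left].
by have [] := comp w Pw; [right|left].
Qed.

Hypotheses (xy : x <= y) (Px : Psi x) (Py : Psi y).
Hypothesis regQ : regular_polytope n Q.
Let hQ := regQ.1.
Hypothesis rigid : forall g : paut F,
  (forall u, Psi (iota u) -> g u = u) -> g = 1%g.

Lemma extension_unique (g h : paut Q) :
  (forall u, g (iota u) = h (iota u)) -> g = h.
Proof.
move=> gh; apply: (paut_eq_flag hQ fPsi) => z /outside[[u ->]//|sz|lz].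
  by rewrite !paut_smallest.
by rewrite !paut_largest.
Qed.

Lemma restriction (g : paut Q) : g x = x -> g y = y ->
  exists h : paut F, forall u, g (iota u) = iota (h u).
Proof.
move=> gx gy.
have stable (k : paut Q) : k x = x -> k y = y ->
    forall u, exists v, k (iota u) = iota v.
  move=> kx ky u; apply/(embedding_image emb).
  rewrite -{1}kx -{1}ky !paut_le; apply/(embedding_image emb).
  by exists u.
have [f fE] := choice (stable g gx gy).
have gVx : (g^-1)%g x = x by rewrite -{1}gx pautKV.
have gVy : (g^-1)%g y = y by rewrite -{1}gy pautKV.
have [f' f'E] := choice (stable (g^-1)%g gVx gVy).
have fK : cancel f f' by move=> u; apply: iota_inj; rewrite -f'E -fE pautKV.
have f'K : cancel f' f by move=> u; apply: iota_inj; rewrite -fE -f'E pautVK.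
have fh : {homo f : u v / u <= v}.
  by move=> u v uv; rewrite -(embedding_le emb) -!fE paut_le (embedding_le emb).
have f'h : {homo f' : u v / u <= v}.
  by move=> u v uv; rewrite -(embedding_le emb) -!f'E paut_le (embedding_le emb).
by exists (PAut fK f'K fh f'h).
Qed.

(** Moving by h the part of Psi that lies in the section gives another flag of Q,
    so regularity provides g that carries Psi to it.  The restriction of g to
    the section agrees with h on a flag of the section, hence everywhere. *)
Lemma extension_exists (h : paut F) :
  exists g : paut Q, forall u, g (iota u) = iota (h u).
Proof.
pose Psi' := [set z | (exists2 u, Psi (iota u) & z = iota (h u)) \/
   (Psi z /\ (smallest_face z \/ largest_face z))].
have fPsi' : flag Psi'.
  apply: (full_chain_flag hQ).
    move=> z w [[u Pu ->]|[Pz sz]] [[v Pv ->]|[Pw sw]].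
    - by rewrite !(embedding_le emb) !paut_le -!(embedding_le emb); apply: fPsi.1.
    - by case: sw => sw; [right|left]; apply: sw.
    - by case: sz => sz; [left|right]; apply: sz.
    - exact: fPsi.1.
  move=> i /(flag_face hQ fPsi)[z Pz rz].
  have [[u zu]|sz|lz] := outside Pz.
  - exists (iota (h u)); first by left; exists u; rewrite -?zu.
    by rewrite (embedding_rank emb) graded_paut_rank // -(embedding_rank emb) -zu.
  - by exists z => //; right; split=> //; left.
  - by exists z => //; right; split=> //; right.
have [g gPsi] := regQ.2 _ _ fPsi fPsi'.
have [ux xE] : exists u, x = iota u.
  by apply/(embedding_image emb); rewrite lexx xy.
have [uy yE] : exists u, y = iota u.
  by apply/(embedding_image emb); rewrite lexx andbT xy.
have lux v : ux <= v.
  rewrite -(embedding_le emb) -xE.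
  by have /(embedding_image emb)/andP[] : exists u, iota v = iota u by exists v.
have luy v : v <= uy.
  rewrite -(embedding_le emb) -yE.
  by have /(embedding_image emb)/andP[] : exists u, iota v = iota u by exists v.
have gh u : Psi (iota u) -> g (iota u) = iota (h u).
  move=> Pu; apply: (chain_rank_inj hQ fPsi'.1).
  - by rewrite -gPsi; exists (iota u).
  - by left; exists u.
  - by rewrite (paut_rank hQ) !(embedding_rank emb) graded_paut_rank.
have fixed u z : z = iota u -> Psi z -> h u = u -> g z = z.
  by move=> -> Pz hu; rewrite gh // hu.
have [k gk] : exists k : paut F, forall u, g (iota u) = iota (k u).
  apply: restriction.
    by apply: (fixed ux) => //; apply: paut_smallest.
  by apply: (fixed uy) => //; apply: paut_largest.
exists g => u; rewrite gk; congr iota.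
suff : (k * h^-1)%g = 1%g by move/divg1_eq ->.
apply: rigid => v Pv; rewrite pautM_app.
by apply: (can_inj (pautKV h)); rewrite pautVK; apply: iota_inj; rewrite -gk gh.
Qed.

Lemma extension_morphism :
  exists E : paut F -> paut Q, {morph E : g h / (g * h)%g} /\
    forall h u, E h (iota u) = iota (h u).
Proof.
have [E EE] := choice extension_exists; exists E; split=> // g h.
by apply: extension_unique => u; rewrite pautM_app !EE pautM_app.
Qed.

End SectionEmbedding.

(** * Faces of the star graphicahedron *)

Section StarFaces.
Local Open Scope group_scope.
Variable q : nat.
Implicit Types (i j : 'I_q) (J : {set 'I_q}) (b : 'S_q.+1) (s : 'S_q).

Notation leaf := (lift (@ord0 q)).

Lemma leaf_neq0 j : (leaf j == ord0) = false.
Proof. by rewrite eq_sym; apply/negbTE; apply: neq_lift. Qed.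

Lemma perm_leaf_eq (b c : 'S_q.+1) : (forall j, b (leaf j) = c (leaf j)) -> b = c.
Proof.
move=> bc; apply/permP => x; have [j ->|->] := unliftP ord0 x; first exact: bc.
apply: (can_inj (permK c^-1)); rewrite permK.
have [k e|->//] := unliftP ord0 (c^-1 (b ord0)).
have := congr1 c e; rewrite permKV -bc => /perm_inj/eqP.
by rewrite eq_sym leaf_neq0.
Qed.

Definition star_edge j : {set 'I_q.+1} := [set ord0; leaf j].

Definition star_edges J : {set {set 'I_q.+1}} := [set star_edge j | j in J].

Lemma star_edge_inj : injective star_edge.
Proof.
move=> i j /setP/(_ (leaf i)); rewrite !inE !eqxx orbT.
by move/esym/orP => [/eqP //|/eqP/lift_inj].
Qed.

Lemma edges_star : edges (star q) = star_edges setT.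
Proof.
apply/setP => e; apply/imsetP/imsetP => [[[x y]]|[j _ ->]].
  rewrite inE /= /star_adj => xy ->.
  case: (unliftP ord0 x) xy => [i ->|->]; case: (unliftP ord0 y) => [j ->|->].
  - by rewrite !leaf_neq0.
  - by exists i; rewrite ?inE //= /star_edge setUC.
  - by exists j; rewrite ?inE.
  - by rewrite eqxx.
by exists (ord0, leaf j); rewrite // inE /= /star_adj eqxx leaf_neq0.
Qed.

Lemma star_edges_sub J : star_edges J \subset edges (star q).
Proof. by rewrite edges_star imsetS // subsetT. Qed.

Lemma star_edgesS J J' : (star_edges J \subset star_edges J') = (J \subset J').
Proof.
apply/idP/idP=> [/subsetP sub|]; last exact: imsetS.
apply/subsetP => i iJ; have /imsetP[j jJ' /star_edge_inj -> //] : star_edge i \in star_edges J'.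
by apply: sub; apply: imset_f.
Qed.

Lemma trgrp_starS J J' : J \subset J' ->
  trgrp (star_edges J) \subset trgrp (star_edges J').
Proof.
rewrite -star_edgesS => sub; apply: genS; apply/subsetP => _ /imsetP[x /[!inE] xJ ->].
by apply/imsetP; exists x => //; rewrite inE (subsetP sub).
Qed.

(** T_J consists of the permutations that fix every leaf outside J.  For the
    inclusion that is not obvious, multiplying b by (0 b(j)) and then by (0 j)
    makes it fix the leaf j of J, and J can be made smaller by j. *)
Lemma trgrp_star J b : reflect (forall j, j \notin J -> b (leaf j) = leaf j)
  (b \in trgrp (star_edges J)).
Proof.
apply: (iffP idP) => [|fixb].
  case/gen_prodgP => n [c cJ ->] j jJ.
  elim: n c cJ => [|n IHn] c cJ; first by rewrite big_ord0 perm1.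
  rewrite big_ord_recr permM IHn; last by move=> k; apply: cJ.
  have /imsetP[[x y]] := cJ ord_max; rewrite inE /= => /imsetP[k kJ exy] ->.
  have kj : k != j by apply: contraNneq jJ => <-.
  have ne z : z \in star_edge k -> z != leaf j.
    by rewrite !inE => /orP[]/eqP ->; rewrite ?neq_lift // (inj_eq lift_inj).
  by rewrite tpermD // ne // -exy !inE eqxx ?orbT.
have tr j : j \in J -> tperm ord0 (leaf j) \in trgrp (star_edges J).
  move=> jJ; apply: mem_gen; apply/imsetP; exists (ord0, leaf j) => //.
  by rewrite inE; apply: imset_f.
have [m] := ubnP #|J|; elim: m J b fixb tr => // m IHm J b fixb tr Jm.
have [J0|[j jJ]] := set_0Vmem J.
  suff -> : b = 1 by apply: group1.
  by apply: perm_leaf_eq => j; rewrite perm1 fixb // J0 inE.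
have trb : tperm ord0 (b (leaf j)) \in trgrp (star_edges J).
  have [k bk|->] := unliftP ord0 (b (leaf j)); last by rewrite tperm1 group1.
  rewrite bk; apply: tr; apply: contraT => kJ.
  by move: bk; rewrite -(fixb k kJ) => /perm_inj/lift_inj e; rewrite -e jJ in kJ.
have sub : trgrp (star_edges (J :\ j)) \subset trgrp (star_edges J).
  exact: trgrp_starS (subsetDl _ _).
rewrite -(mulgK (tperm ord0 (b (leaf j)) * tperm ord0 (leaf j)) b).
apply: groupM; last by rewrite groupV groupM ?tr.
apply: (subsetP sub).
apply: IHm => [i iJ|i iJ|]; last by rewrite (cardsD1 j) jJ in Jm.
  rewrite !permM; have [->|ij] := eqVneq i j; first by rewrite tpermR tpermL.
  have iJ' : i \notin J by move: iJ; rewrite !inE ij.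
  have nb : b (leaf j) != leaf i.
    by rewrite -(fixb i iJ') (inj_eq perm_inj) (inj_eq lift_inj) eq_sym.
  have nj : leaf j != leaf i by rewrite (inj_eq lift_inj) eq_sym.
  by rewrite (fixb i iJ') tpermD ?neq_lift // tpermD ?neq_lift.
apply: mem_gen; apply/imsetP; exists (ord0, leaf i) => //.
by rewrite inE; apply: imset_f.
Qed.

Definition star_pair J b : gpair (star q) := exist _ (star_edges J, b) (star_edges_sub J).

Definition star_face J b : graphicahedron (star q) := Some (gclass_of (star_pair J b)).

Lemma sub_trgrp_rcoset J J' b b' : J \subset J' ->
  (trgrp (star_edges J) :* b \subset trgrp (star_edges J') :* b') <->
  forall j, j \notin J' -> b (leaf j) = b' (leaf j).
Proof.
move=> JJ'; transitivity (b * b'^-1 \in trgrp (star_edges J')).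
  rewrite -mem_rcoset; split=> [/subsetP|bJ'].
    by apply; apply: rcoset_refl.
  by rewrite -(rcoset_eqP bJ'); apply/mulSg/trgrp_starS.
split=> [/trgrp_star h j /h|h].
  by rewrite permM => /(congr1 b'); rewrite permKV.
by apply/trgrp_star => j /h; rewrite permM => ->; rewrite permK.
Qed.

(** For J contained in J', the coset T_J b lies in T_J' b' as soon as b b'^-1 is
    in T_J', which [trgrp_star] describes. *)
Lemma star_face_le J J' b b' :
  (star_face J b <= star_face J' b')%O <->
  J \subset J' /\ forall j, j \notin J' -> b (leaf j) = b' (leaf j).
Proof.
rewrite /Order.le /= gclass_le_of /gpair_le /gpair_coset /= star_edgesS.
split=> [/andP[JJ' /(sub_trgrp_rcoset _ _ JJ')//]|[JJ' h]].
by apply/andP; split=> //; apply/(sub_trgrp_rcoset _ _ JJ').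
Qed.

Lemma star_face_rank J b : rank (star_face J b) = (#|J|%:Z)%R.
Proof. by rewrite /= gclass_rank_of /= card_imset //; apply: star_edge_inj. Qed.

Lemma star_face_eq J J' b b' : star_face J b = star_face J' b' <->
  J = J' /\ forall j, j \notin J' -> b (leaf j) = b' (leaf j).
Proof.
split=> [e|[<- h]].
  have := lexx (star_face J b); rewrite {1}e => /star_face_le[J'J _].
  have := lexx (star_face J b); rewrite {2}e => /star_face_le[JJ' h].
  by split=> //; apply/eqP; rewrite eqEsubset JJ'.
by apply/le_anti/andP; split; apply/star_face_le; split=> // j /h.
Qed.

Definition star_support (u : gclass (star q)) : {set 'I_q} :=
  [set j | star_edge j \in (val (gclass_repr u)).1].

Lemma star_support_pair (u : gclass (star q)) :
  gclass_repr u = star_pair (star_support u) (val (gclass_repr u)).2.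
Proof.
apply: val_inj; rewrite /= [LHS]surjective_pairing; congr pair.
apply/setP => e; apply/idP/imsetP => [eK|[j]]; last by rewrite inE => + ->.
have := subsetP (valP (gclass_repr u)) _ eK.
rewrite edges_star => /imsetP[j _ ej]; exists j => //.
by rewrite inE -ej.
Qed.

Lemma gclass_repr_star J b (u := gclass_of (star_pair J b)) :
  star_support u = J /\
  forall j, j \notin J -> (val (gclass_repr u)).2 (leaf j) = b (leaf j).
Proof.
apply/star_face_eq; rewrite [RHS]/star_face -/u.
by rewrite /star_face -star_support_pair gclass_reprK.
Qed.

Lemma star_faceP (x : graphicahedron (star q)) :
  x = None \/ exists J b, x = star_face J b.
Proof.
case: x => [u|]; [right | by left].
exists (star_support u), (val (gclass_repr u)).2.
by rewrite /star_face -star_support_pair gclass_reprK.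
Qed.

End StarFaces.

(** * The action of permutations of the vertices and of the leaves *)

Section StarAction.
Local Open Scope group_scope.
Variable q : nat.
Implicit Types (i j : 'I_q) (J : {set 'I_q}) (b : 'S_q.+1) (s : 'S_q).
Notation leaf := (lift (@ord0 q)).

Definition hub_lift s : 'S_q.+1 := lift_perm ord0 ord0 s.

Lemma hub_lift_leaf s j : hub_lift s (leaf j) = leaf (s j).
Proof. exact: lift_perm_lift. Qed.

Lemma hub_lift0 s : hub_lift s ord0 = ord0.
Proof. exact: lift_perm_id. Qed.

Lemma hub_liftM s t : hub_lift (s * t) = hub_lift s * hub_lift t.
Proof. by rewrite /hub_lift -(lift_permM _ ord0). Qed.

Lemma hub_liftV s : hub_lift s^-1 = (hub_lift s)^-1.
Proof. by rewrite /hub_lift lift_permV. Qed.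

Lemma hub_lift1 : hub_lift 1 = 1.
Proof. exact: lift_perm1. Qed.

(** Left multiplication by the inverse of the lift of s maps a right coset of
    T_J to one of the group of the relabelled set s(J).  Since left and right
    translations commute, the pairs (a, s) act as a direct product. *)
Definition star_act_fun (a : 'S_q.+1) (s : 'S_q) (x : graphicahedron (star q)) :
    graphicahedron (star q) :=
  if x is Some u then
    star_face (s @: star_support u)
      ((hub_lift s)^-1 * (val (gclass_repr u)).2 * a)
  else None.

Lemma star_act_fun_face a s J b :
  star_act_fun a s (star_face J b) = star_face (s @: J) ((hub_lift s)^-1 * b * a).
Proof.
have [JE e] := gclass_repr_star J b.
rewrite /star_act_fun {1}/star_face JE; apply/star_face_eq; split=> // j jJ.
rewrite !permM -hub_liftV hub_lift_leaf e //.
by apply: contra jJ => sj; rewrite -(permKV s j) imset_f.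
Qed.

Lemma star_act_funK a s : cancel (star_act_fun a s) (star_act_fun a^-1 s^-1).
Proof.
move=> x; have [->//|[J [b ->]]] := star_faceP x; rewrite !star_act_fun_face.
congr star_face; last by rewrite hub_liftV invgK !mulgA mulgV mul1g mulgK.
rewrite -imset_comp -[RHS]imset_id; apply: eq_imset => j /=.
by rewrite permK.
Qed.

Lemma star_act_fun_homo a s : {homo star_act_fun a s : x y / (x <= y)%O}.
Proof.
move=> x y; have [->//|[J [b ->]]] := star_faceP x.
have [->//|[J' [b' ->]]] := star_faceP y.
rewrite !star_act_fun_face => /star_face_le[JJ' e]; apply/star_face_le.
split=> [|j jJ']; first exact: imsetS.
rewrite !permM -hub_liftV hub_lift_leaf e //.
by apply: contra jJ' => sj; rewrite -(permKV s j) imset_f.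
Qed.

Lemma star_act_funVK a s : cancel (star_act_fun a^-1 s^-1) (star_act_fun a s).
Proof. by move=> x; rewrite -{2}(star_act_funK a^-1 s^-1 x) !invgK. Qed.

Definition star_act a s : paut (graphicahedron (star q)) :=
  PAut (@star_act_funK a s) (@star_act_funVK a s)
    (@star_act_fun_homo a s) (@star_act_fun_homo a^-1 s^-1).

Lemma star_act_face a s J b :
  star_act a s (star_face J b) = star_face (s @: J) ((hub_lift s)^-1 * b * a).
Proof. exact: star_act_fun_face. Qed.

Lemma star_actM a s a' s' :
  star_act (a * a') (s * s') = (star_act a s * star_act a' s')%g.
Proof.
apply: pautP => x; rewrite pautM_app; have [->//|[J [b ->]]] := star_faceP x.
rewrite !star_act_face -imset_comp; congr star_face.
  by apply: eq_imset => j; rewrite permM.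
by rewrite hub_liftM invMg !mulgA.
Qed.

End StarAction.

(** * The star graphicahedron is a regular polytope *)

Section StarPolytope.
Local Open Scope group_scope.
Variable q : nat.
Implicit Types (i j : 'I_q) (J : {set 'I_q}) (b : 'S_q.+1) (s p : 'S_q).
Notation leaf := (lift (@ord0 q)).
Notation P := (graphicahedron (star q)).

Lemma star_rank_range J : (#|J| <= q)%N.
Proof. by rewrite -[X in (_ <= X)%N]card_ord max_card. Qed.

Lemma star_rank_bottom : rank (None : P) = (-1)%R.
Proof. by []. Qed.

Lemma star_ranked : ranked q P.
Proof.
split=> [x y|x].
  have [->|[J [b ->]]] := star_faceP x; have [->//|[J' [b' ->]]] := star_faceP y.
    by move=> _; rewrite star_face_rank star_rank_bottom; lia.
  rewrite lt_neqAle => /andP[ne /star_face_le[JJ' e]]; rewrite !star_face_rank.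
  have := subset_leq_card JJ'; rewrite leq_eqVlt => /orP[/eqP cJ|]; last by lia.
  by case/eqP: ne; apply/star_face_eq; split=> //; apply/eqP; rewrite eqEcard JJ' cJ /=.
have [->|[J [b ->]]] := star_faceP x; rewrite ?star_face_rank ?star_rank_bottom; first by lia.
by have := star_rank_range J; lia.
Qed.

Lemma star_smallest : smallest_face (None : P).
Proof. by []. Qed.

Lemma star_largest : largest_face (star_face [set: 'I_q] 1 : P).
Proof.
move=> x; have [->//|[J [b ->]]] := star_faceP x.
by apply/star_face_le; split=> [|j]; rewrite ?subsetT ?inE.
Qed.

Lemma subset_between (J K : {set 'I_q}) (k : nat) :
  J \subset K -> (#|J| <= k <= #|K|)%N ->
  exists L : {set 'I_q}, [/\ J \subset L, L \subset K & #|L| = k].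
Proof.
move=> JK /andP[Jk kK].
pose D := [set x in take (k - #|J|) (enum (K :\: J))].
have DE x : x \in D -> x \in K :\: J by rewrite inE => /mem_take; rewrite mem_enum.
exists (J :|: D); split; first exact: subsetUl.
  by rewrite subUset JK; apply/subsetP => x /DE /setDP[].
have D0 : J :&: D = finset.set0.
  by apply/setP => x; rewrite !inE; apply/negbTE/negP => /andP[xJ] xD;
    have := DE x; rewrite !inE xJ => /(_ xD).
rewrite cardsU D0 cards0 subn0 cardsE.
have /card_uniqP -> : uniq (take (k - #|J|) (enum (K :\: J))).
  by rewrite take_uniq // enum_uniq.
rewrite size_take -cardE cardsD (setIidPr JK).
by case: ltnP; lia.
Qed.

Lemma star_dense (x y : P) (i : int) : (x <= y)%O -> (rank x < i < rank y)%R ->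
  exists2 z, (x <= z <= y)%O & rank z = i.
Proof.
have [->|[J [b ->]]] := star_faceP y.
  have [->|[J' [b' ->]]] := star_faceP x; last by [].
  by rewrite star_rank_bottom; lia.
rewrite star_face_rank; have [-> _|[J' [b' ->]]] := star_faceP x.
  rewrite star_rank_bottom => hi; have [||L [_ LJ cL]] := @subset_between finset.set0 J (absz i).
  - exact: sub0set.
  - by rewrite cards0; lia.
  exists (star_face L b); last by rewrite star_face_rank cL; lia.
  by apply/andP; split=> //; apply/star_face_le.
move=> /star_face_le[JJ e]; rewrite star_face_rank => hi.
have [|L [JL LJ cL]] := @subset_between J' J (absz i) JJ; first by lia.
exists (star_face L b'); last by rewrite star_face_rank cL; lia.
by apply/andP; split; apply/star_face_le.
Qed.

Lemma star_flag_full (Phi : set P) : flag Phi ->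
  forall i : int, (-1 <= i <= q%:Z)%R -> exists2 x, Phi x & rank x = i.
Proof.
apply: (dense_flag_full star_ranked star_smallest star_largest) => //.
  by rewrite star_face_rank cardsT card_ord.
exact: star_dense.
Qed.

Definition initial p (k : nat) : {set 'I_q} := p @: [set j : 'I_q | (j < k)%N].

Lemma mem_initial p k j : (j \in initial p k) = (p^-1 j < k)%N.
Proof.
rewrite -{1}(permKV p j) /initial (mem_imset _ _ perm_inj).
by rewrite inE.
Qed.

Lemma card_initial p k : (k <= q)%N -> #|initial p k| = k.
Proof.
move=> kq; rewrite card_imset; last exact: perm_inj.
have -> : [set j : 'I_q | (j < k)%N] = [set widen_ord kq x | x : 'I_k].
  apply/setP => j; rewrite inE; apply/idP/imsetP => [jk|[x _ ->]]; last exact: (ltn_ord x).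
  by exists (Ordinal jk) => //; apply: val_inj.
by rewrite card_imset ?card_ord // => x y /(congr1 val) /= /val_inj.
Qed.

Lemma initial_sub p k l : (k <= l)%N -> initial p k \subset initial p l.
Proof.
move=> kl; apply/subsetP => j; rewrite !mem_initial => /leq_trans; exact.
Qed.

Lemma imset_initial p s k : s @: initial p k = initial (p * s) k.
Proof. by rewrite /initial -imset_comp; apply: eq_imset => j; rewrite permM. Qed.

Definition star_flag p b : set P :=
  [set x : P | x = None \/ exists2 k : nat, (k <= q)%N & x = star_face (initial p k) b]%classic.

Lemma star_flagP p b : flag (star_flag p b).
Proof.
apply: (full_chain_flag star_ranked).
  move=> x y [->|[k kq ->]] [->|[l lq ->]]; [by left|by left|by right|].
  have [kl|/ltnW lk] := leqP k l; [left|right]; apply/star_face_le;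
    by split=> //; apply: initial_sub.
move=> i hi; have [im|im] := eqVneq i (-1)%R; first by exists None; [left|].
exists (star_face (initial p (absz i)) b).
  by right; exists (absz i) => //; lia.
by rewrite star_face_rank card_initial; lia.
Qed.

(** The vertex of the flag provides b, and p lists the leaves in the order in which
    they enter the sets J of the faces of the flag. *)
Lemma star_flag_exists (Phi : set P) : flag Phi -> exists p b, Phi = star_flag p b.
Proof.
move=> fPhi; have [cPhi _] := fPhi.
have [|x0 P0 r0] := star_flag_full fPhi (i := 0%R); first by lia.
have [e|[J0 [b x0E]]] := star_faceP x0; first by rewrite e in r0.
subst x0; have J0E : J0 = finset.set0.
  by apply/eqP; rewrite -cards_eq0; move: r0; rewrite star_face_rank; lia.
have /choice[J JP] (k : nat) : exists K : {set 'I_q}, (k <= q)%N ->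
    Phi (star_face K b) /\ #|K| = k.
  have [kq|qk] := leqP k q; last by exists finset.set0; lia.
  have [|x Px rx] := star_flag_full fPhi (i := (k%:Z)%R); first by lia.
  have [e|[K [b' xE]]] := star_faceP x; first by rewrite e star_rank_bottom in rx; lia.
  subst x; have : (star_face J0 b <= star_face K b')%O.
    by apply: (chain_rank_le star_ranked cPhi) => //; rewrite r0 rx; lia.
  move=> /star_face_le[_ e]; exists K => _; split; last first.
    by move: rx; rewrite star_face_rank; lia.
  suff -> : star_face K b = star_face K b' by [].
  exact/star_face_eq.
have Jsub k l : (k <= l <= q)%N -> J k \subset J l.
  move=> /andP[kl lq]; have [Pk ck] := JP k (leq_trans kl lq).
  have [Pl cl] := JP l lq.
  suff /star_face_le[] : (star_face (J k) b <= star_face (J l) b)%O by [].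
  by apply: (chain_rank_le star_ranked cPhi) => //; rewrite !star_face_rank ck cl; lia.
have /choice[f fP] (k : 'I_q) : exists j, j \in J k.+1 :\: J k.
  apply/set0Pn; rewrite -card_gt0; have kq := ltn_ord k.
  rewrite cardsD (setIidPr _); last by apply: Jsub; rewrite leqnSn.
  by rewrite (JP k.+1 kq).2 (JP k (ltnW kq)).2 subSn // subnn.
have flt (k l : 'I_q) : (k < l)%N -> f k != f l.
  move=> kl; have /setDP[fk _] := fP k; have /setDP[_ fl] := fP l.
  apply: contraNneq fl => <-; apply: subsetP fk; apply: Jsub.
  by rewrite kl ltnW.
have finj : injective f.
  move=> k l e; case: (ltngtP k l) => [/flt|/flt|/val_inj //]; by rewrite e eqxx.
pose p := perm finj.
have iE k : (k <= q)%N -> initial p k = J k.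
  move=> kq; apply/eqP; rewrite eqEcard card_initial // (JP k kq).2 leqnn andbT.
  apply/subsetP => y /imsetP[l]; rewrite inE => lk ->; rewrite permE.
  have /setDP[fl _] := fP l; apply: subsetP fl; apply: Jsub.
  by rewrite lk.
exists p, b; apply/esym; apply: flag_ext => //; first exact: star_flagP.
move=> x [->|[k kq ->]]; first exact: (smallest_flag fPhi star_smallest).
by rewrite iE //; have [] := JP k kq.
Qed.

End StarPolytope.

(** The relation behind [flag_joined], with an arbitrary set X instead of the
    intersection of the two end flags, so that paths can be concatenated. *)
Section JoinedIn.
Local Open Scope classical_set_scope.
Variables (P : rposet) (X : set P).

Definition joined_in (Phi Psi : set P) : Prop :=
  exists (k : nat) (c : nat -> set P),
    [/\ c 0%N = Phi, c k = Psi,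
        forall i, (i <= k)%N -> flag (c i) /\ X `<=` c i
      & forall i, (i < k)%N -> adjacent (c i) (c i.+1)].

Lemma joined_in_refl Phi : flag Phi -> X `<=` Phi -> joined_in Phi Phi.
Proof. by move=> fPhi XPhi; exists 0%N, (fun=> Phi). Qed.

Lemma joined_in_step Phi Psi : flag Phi -> flag Psi -> X `<=` Phi -> X `<=` Psi ->
  adjacent Phi Psi -> joined_in Phi Psi.
Proof.
move=> fPhi fPsi XPhi XPsi a; exists 1%N, (fun i => if i is 0 then Phi else Psi).
by split=> // [[|i] _|[|i]].
Qed.

Lemma joined_in_trans Phi Psi Xi : joined_in Phi Psi -> joined_in Psi Xi ->
  joined_in Phi Xi.
Proof.
move=> [k [c [c0 ck cf ca]]] [l [d [d0 dl df da]]].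
exists (k + l)%N, (fun i => if (i < k)%N then c i else d (i - k)%N); split.
- by case: ltnP => // k0; rewrite sub0n d0 -ck -c0; congr c; lia.
- by rewrite ltnNge leq_addr /= addKn.
- move=> i ikl; case: ltnP => ik; first exact: cf (ltnW ik).
  by apply: df; lia.
move=> i ikl; case: ltnP => ik.
  case: ltnP => ik'; first exact: ca.
  have e : i.+1 = k by lia.
  by rewrite -e subnn d0 -ck -e; apply: ca; lia.
rewrite ltnNge leqW //= subSn //; apply: da; lia.
Qed.

End JoinedIn.

Section StarConnected.
Local Open Scope group_scope.
Variable q : nat.
Implicit Types (i j : 'I_q) (J : {set 'I_q}) (b : 'S_q.+1) (s p : 'S_q).
Notation leaf := (lift (@ord0 q)).
Notation P := (graphicahedron (star q)).

Lemma star_flag_mem p b k : (k <= q)%N -> star_flag p b (star_face (initial p k) b).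
Proof. by move=> kq; right; exists k. Qed.

Lemma star_flag_adjacent_at (k : nat) (p p' : 'S_q) (b b' : 'S_q.+1) : (k <= q)%N ->
  star_face (initial p k) b <> star_face (initial p' k) b' ->
  (forall l, (l <= q)%N -> l != k ->
     star_face (initial p l) b = star_face (initial p' l) b') ->
  adjacent_at (k%:Z)%R (star_flag p b) (star_flag p' b').
Proof.
move=> kq ne eq; split.
  move=> e; apply: ne; have := star_flag_mem p' b' kq; rewrite -e.
  move=> [//|[l lq el]]; rewrite el; congr star_face; congr initial.
  by move/(congr1 (@rank P)): el; rewrite !star_face_rank !card_initial //; lia.
have sub p1 b1 p2 b2 x : (forall l, (l <= q)%N -> l != k ->
     star_face (initial p1 l) b1 = star_face (initial p2 l) b2) ->
     rank x <> (k%:Z)%R -> star_flag p1 b1 x -> star_flag p2 b2 x.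
  move=> eq' rx [->|[l lq xE]]; first by left.
  rewrite xE; right; exists l => //; apply: eq' => //; apply/eqP => lk.
  by apply: rx; rewrite xE star_face_rank card_initial // lk.
by move=> x rx; split; apply: sub rx => // l lq lk; rewrite eq.
Qed.

Lemma initial_eq_swap p (i i' : 'I_q) k : (i' = i.+1 :> nat) -> k != i.+1 ->
  initial (tperm i i' * p) k = initial p k.
Proof.
move=> ii' ki; apply/setP => j; rewrite !mem_initial invMg tpermV permM.
by case: tpermP => [->|->|//]; rewrite ii'; lia.
Qed.

Lemma increasing_perm_id (w : 'S_q) :
  (forall i i' : 'I_q, i' = i.+1 :> nat -> (w i < w i')%N) -> w = 1.
Proof.
move=> inc; have ge (n : nat) i : i = n :> nat -> (i <= w i)%N.
  elim: n i => [|n IHn] i ei; first by rewrite ei.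
  have nq : (n < q)%N by rewrite ltnW // -ei.
  by have := IHn (Ordinal nq) erefl; have := inc (Ordinal nq) i ei; rewrite /=; lia.
have fix_ (d : nat) i : (q - i <= d)%N -> w i = i.
  elim: d i => [|d IHd] i id; first by have := ltn_ord i; lia.
  apply/val_inj/eqP; rewrite /= eqn_leq (ge _ i erefl) // andbT leqNgt.
  apply/negP => wi; have e : w (w i) = w i by apply: IHd; lia.
  by rewrite (perm_inj e) ltnn in wi.
by apply/permP => i; rewrite perm1; apply: (fix_ (q - i)%N).
Qed.

(** As in bubble sort, the order p is brought closer to p' by swapping
    neighbouring leaves that are in the wrong order for p'.  The face that the
    swap changes is not in X, since its set of leaves is not an initial set of
    p'.  The number sum_i i * pos(i), where pos(i) is the position in p' of
    the i-th leaf of p, is bounded and grows at each swap. *)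
Lemma star_reorder (X : set P) p p' b :
  (X `<=` star_flag p b)%classic -> (X `<=` star_flag p' b)%classic ->
  joined_in X (star_flag p b) (star_flag p' b).
Proof.
move=> Xp Xp'; pose pos (r : 'S_q) : 'S_q := r * p'^-1.
pose weight (r : 'S_q) := (\sum_(i : 'I_q) i * pos r i)%N.
have weight_le r : (weight r <= q * (q * q))%N.
  rewrite /weight -[X in (_ <= X * _)%N]card_ord -sum_nat_const; apply: leq_sum => i _.
  by apply: leq_mul; apply: ltnW; apply: ltn_ord.
have [d] := ubnP (q * (q * q) - weight p)%N; elim: d p Xp => // d IHd p Xp wd.
have [inc|/existsNP[i /existsNP[i' /not_implyP[ii' /negP wi]]]] := pselect
    (forall i i' : 'I_q, i' = i.+1 :> nat -> (pos p i < pos p i')%N).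
  have -> : p = p' by apply/(mulIg p'^-1); rewrite mulgV; apply: increasing_perm_id.
  exact: joined_in_refl (star_flagP _ _) Xp'.
have nii : i != i' by rewrite -val_eqE /= ii' neq_ltn ltnSn.
have wlt : (pos p i' < pos p i)%N.
  rewrite ltn_neqAle leqNgt wi andbT.
  by apply: contraNneq nii => /val_inj/perm_inj ->.
pose r := tperm i i' * p.
have rgt : (weight p < weight r)%N.
  rewrite /weight (bigD1 i) //= (bigD1 i') 1?eq_sym //=.
  rewrite [X in (_ < X)%N](bigD1 i) //= [X in (_ < _ + X)%N](bigD1 i') 1?eq_sym //=.
  rewrite /pos /r !permM tpermL tpermR (eq_bigr (fun k : 'I_q => k * pos r k)%N).
    by move: wlt; rewrite /pos !permM ii'; set A := \sum_(_ | _) _; nia.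
  by move=> k /andP[ki ki']; rewrite /pos /r !permM tpermD // eq_sym.
have Xr : (X `<=` star_flag r b)%classic.
  move=> x Xx; have [xN|[k kq xE]] := Xp x Xx; first by left.
  have [xN|[l lq xE']] := Xp' x Xx; first by left.
  right; exists k => //; rewrite xE.
  have [ki|ki] := eqVneq k i.+1; last by rewrite initial_eq_swap.
  have /star_face_eq[e _] : star_face (initial p k) b = star_face (initial p' l) b.
    by rewrite -xE.
  have : p i \in initial p' l by rewrite -e mem_initial permK ki.
  have : p i' \notin initial p' l by rewrite -e mem_initial permK ki ii' ltnn.
  rewrite !mem_initial => h1 h2; move: wlt; rewrite /pos !permM.
  by move: h1 h2; lia.
apply: joined_in_trans (IHd r Xr _); last by have := weight_le r; lia.
apply: joined_in_step => //; try exact: star_flagP.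
have iq : (i.+1 <= q)%N by apply: ltn_ord.
exists (i.+1%:Z)%R; apply: (star_flag_adjacent_at iq);
  last by move=> l lq li; rewrite initial_eq_swap.
move=> /star_face_eq[/setP/(_ (p i))]; rewrite !mem_initial permK leqnn.
by rewrite /r invMg tpermV permM permK tpermL ii' ltnn.
Qed.


(** Write w as a product of transpositions (0 j) where j is among the first m
    leaves.  To apply one of them, bring j to the front by reordering these m
    leaves, change the vertex of the flag, which multiplies b by (0 j), and
    restore the order.  Only faces of rank below m change. *)
Lemma star_rebase (X : set P) p b m (w : 'S_q.+1) :
  w \in trgrp (star_edges (initial p m)) ->
  (forall x, X x -> x = None \/
     exists2 k, (m <= k <= q)%N & x = star_face (initial p k) b) ->
  joined_in X (star_flag p b) (star_flag p (w * b)).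
Proof.
pose upper (c : 'S_q.+1) := forall x, X x -> x = None \/
     exists2 k, (m <= k <= q)%N & x = star_face (initial p k) c.
have rebase c t : t \in trgrp (star_edges (initial p m)) -> upper c -> upper (t * c).
  move=> /trgrp_star tE uc x /uc[->|[k mkq ->]]; [by left|right; exists k => //].
  apply/star_face_eq; split=> // j jk; rewrite permM tE //.
  by apply: contra jk; apply: subsetP; apply: initial_sub; case/andP: mkq.
have up_flag c : upper c -> (X `<=` star_flag p c)%classic.
  move=> uc x /uc[->|[k /andP[_ kq] ->]]; [by left|by right; exists k].
have step c i : (i < m)%N -> upper c ->
    joined_in X (star_flag p c) (star_flag p (tperm ord0 (leaf (p i)) * c)).
  move=> im uc; have q0 : (0 < q)%N by apply: leq_ltn_trans (ltn_ord i).
  pose t := tperm ord0 (leaf (p i)).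
  have tT : t \in trgrp (star_edges (initial p m)).
    apply/trgrp_star => j; rewrite mem_initial => jm; rewrite tpermD ?neq_lift //.
    by rewrite (inj_eq lift_inj); apply: contraNneq jm => <-; rewrite permK.
  pose p1 := tperm (Ordinal q0) i * p.
  have p1E k : (m <= k)%N -> initial p1 k = initial p k.
    move=> mk; apply/setP => j; rewrite !mem_initial /p1 invMg tpermV permM.
    by case: tpermP => [->|->|_ _] //=; lia.
  have up1 c' : upper c' -> (X `<=` star_flag p1 c')%classic.
    move=> uc' x /uc'[->|[k /andP[mk kq] ->]]; first by left.
    by right; exists k => //; rewrite p1E.
  have ut := rebase _ _ tT uc.
  apply: (joined_in_trans (star_reorder (up_flag _ uc) (up1 _ uc))).
  apply: (joined_in_trans _ (star_reorder (up1 _ ut) (up_flag _ ut))).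
  apply: joined_in_step; try exact: star_flagP; try exact: up1.
  have p10 : p1 (Ordinal q0) = p i by rewrite permM tpermL.
  exists 0%R; apply: (star_flag_adjacent_at (k := 0)) => //.
    move=> /star_face_eq[_ /(_ (p i))]; rewrite mem_initial ltn0 => /(_ isT).
    by rewrite permM tpermR => /perm_inj/eqP; rewrite leaf_neq0.
  move=> l lq l0; apply/star_face_eq; split=> // j jl.
  rewrite permM tpermD ?neq_lift // (inj_eq lift_inj).
  apply: contraNneq jl => <-; rewrite mem_initial -p10 permK /=.
  by rewrite lt0n.
move=> wT ub; case/gen_prodgP: wT => n [t tT ->].
elim: n t tT => [|n IHn] t tT.
  rewrite big_ord0 mul1g; apply: joined_in_refl; [exact: star_flagP|exact: up_flag].
rewrite big_ord_recl -mulgA.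
have tT' k : t (lift ord0 k) \in [set tperm x.1 x.2 | x : 'I_q.+1 * 'I_q.+1 &
    [set x.1; x.2] \in star_edges (initial p m)] by apply: tT.
apply: (joined_in_trans (IHn _ tT')).
have u' : upper ((\prod_(k < n) t (lift ord0 k)) * b).
  apply: (rebase _ _ _ ub); apply: group_prod => k _; apply: mem_gen; exact: tT'.
have /imsetP[[x y]] := tT ord0; rewrite inE /= => /imsetP[j jm exy] ->.
have -> : tperm x y = tperm ord0 (leaf (p (p^-1 j))).
  rewrite permKV; have hx : x \in star_edge j by rewrite -exy !inE eqxx.
  have hy : y \in star_edge j by rewrite -exy !inE eqxx orbT.
  have h0 : ord0 \in [set x; y] by rewrite exy !inE eqxx.
  have hj : leaf j \in [set x; y] by rewrite exy !inE eqxx orbT.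
  move: hx hy h0 hj; rewrite !inE.
  move=> /orP[]/eqP -> /orP[]/eqP -> // _ _.
  exact: tpermC.
by apply: step => //; rewrite mem_initial in jm.
Qed.

(** Let m be the least rank of a proper common face.  First reorder the leaves;
    then b and b' differ by an element of T_J for the common m-face (J, b). *)
Lemma star_flag_connected (Phi Psi : set P) : flag Phi -> flag Psi ->
  flag_joined Phi Psi.
Proof.
move=> /star_flag_exists[p [b ->]] /star_flag_exists[p' [b' ->]].
set X := (star_flag p b `&` star_flag p' b')%classic.
change (joined_in X (star_flag p b) (star_flag p' b')).
have XE x : X x -> x = None \/ exists k, [/\ (k <= q)%N, x = star_face (initial p k) b,
    x = star_face (initial p' k) b' & initial p k = initial p' k].
  move=> [[->|[k kq xk]] [xN|[l lq xl]]]; [by left|by left|by left|right].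
  have kl : k = l.
    by move/(congr1 (@rank P)): (xk); rewrite {1}xl !star_face_rank !card_initial //; lia.
  subst l; exists k; split=> //.
  have /star_face_eq[] // : star_face (initial p k) b = star_face (initial p' k) b'.
  by rewrite -xk.
have exm : exists k, (k <= q)%N && `[< X (star_face (initial p k) b) >].
  exists q; rewrite leqnn; apply/asboolP; split; first by right; exists q.
  right; exists q => //; apply/star_face_eq.
  have full r : initial r q = [set: 'I_q].
    by apply/setP => j; rewrite mem_initial inE ltn_ord.
  by rewrite !full; split=> // j; rewrite inE.
case: (ex_minnP exm) => m /andP[mq /asboolP Xm] minm.
have Xup x : X x -> x = None \/
    exists2 k, (m <= k <= q)%N & x = star_face (initial p' k) b.
  move=> Xx; have [->|[k [kq xk xk' e]]] := XE x Xx; [by left|right].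
  exists k; last by rewrite -e.
  by rewrite kq andbT minm // kq; apply/asboolP; rewrite -xk.
have XF : (X `<=` star_flag p' b)%classic.
  by move=> x /Xup[->|[k /andP[_ kq] ->]]; [left|right; exists k].
have [//|[k [kq ek ek' e]]] := XE _ Xm.
have km : k = m.
  by move/(congr1 (@rank P)): ek; rewrite !star_face_rank !card_initial //; lia.
subst k; have -> : b' = (b' * b^-1) * b by rewrite mulgKV.
apply: joined_in_trans (star_rebase _ Xup).
  by apply: star_reorder XF => x [].
have /star_face_eq[_ agree] : star_face (initial p m) b = star_face (initial p' m) b'.
  by rewrite -ek'.
by apply/trgrp_star => j jm; rewrite permM -agree // permK.
Qed.

(** Below an edge with J = {a} the vertices are b and (0 a) b; above rank 0 the
    interval consists of the two ways to add one of the two missing leaves. *)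
Lemma star_diamond (j : int) (x y : P) : (x <= y)%O ->
  rank x = (j - 1)%R -> rank y = (j + 1)%R ->
  exists z1 z2 : P,
    z1 <> z2 /\ ([set z | rank z = j /\ (x <= z <= y)%O] = [set z1; z2])%classic.
Proof.
have [->|[J' [b' ->]]] := star_faceP y.
  have [->|[J [b ->]]] := star_faceP x; last by [].
  by rewrite star_rank_bottom; lia.
have [-> _|[J [b ->]]] := star_faceP x.
  rewrite star_rank_bottom star_face_rank => rx ry.
  have j0 : j = 0%R by lia.
  subst j; have /cards1P[a ->] : #|J'| == 1%N by lia.
  pose t := tperm ord0 (leaf a).
  exists (star_face finset.set0 b'), (star_face finset.set0 (t * b')); split.
    move=> /star_face_eq[_ /(_ a)]; rewrite inE => /(_ isT).
    by rewrite permM tpermR => /perm_inj/eqP; rewrite leaf_neq0.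
  apply/seteqP; split=> z; last first.
    move=> [->|->]; (split; first by rewrite star_face_rank cards0); apply/andP; split=> //.
      by apply/star_face_le; split; rewrite ?sub0set.
    apply/star_face_le; split=> [|k]; rewrite ?sub0set // inE => ka.
    by rewrite permM tpermD // ?neq_lift // (inj_eq lift_inj) eq_sym.
  move=> [rz zy]; have [e|[K [c zE]]] := star_faceP z; first by rewrite e in rz.
  subst z; move: rz; rewrite star_face_rank => cK.
  have K0 : K = finset.set0 by apply/eqP; rewrite -cards_eq0; lia.
  subst K; move: zy => /star_face_le[_ agree].
  have agr k : k != a -> c (leaf k) = b' (leaf k) by move=> ka; apply: agree; rewrite inE.
  have [k ek|e0] := unliftP ord0 (b'^-1 (c (leaf a))).
    left; apply/star_face_eq; split=> // l _; have [->|la] := eqVneq l a; last exact: agr.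
    have ca : c (leaf a) = b' (leaf k) by rewrite -ek permKV.
    have [ka|ka] := eqVneq k a; first by rewrite -ka -ca ka.
    by move: ca; rewrite -(agr k ka) => /perm_inj/lift_inj ak; rewrite ak eqxx in ka.
  right; apply/star_face_eq; split=> // l _; have [->|la] := eqVneq l a.
    by rewrite permM tpermR; move/(congr1 b'): e0; rewrite permKV.
  by rewrite permM tpermD ?neq_lift // ?agr // (inj_eq lift_inj) eq_sym.
move=> /star_face_le[JJ' agree]; rewrite !star_face_rank => rx ry.
have -> : star_face J' b' = star_face J' b.
  by apply/star_face_eq; split=> // k kJ; rewrite agree.
have /cards2P[a [c [ac D]]] : #|J' :\: J| == 2%N.
  by rewrite cardsD (setIidPr JJ'); lia.
have mem k : (k \in J' :\: J) = (k == a) || (k == c) by rewrite D !inE.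
have aD := mem a; have cD := mem c; rewrite !eqxx ?orbT /= in aD cD.
have [/setDP[aJ' aJ] /setDP[cJ' cJ]] := (aD, cD).
have le K : (star_face J b <= star_face K b <= star_face J' b)%O <->
    J \subset K /\ K \subset J'.
  by split=> [/andP[/star_face_le[-> _] /star_face_le[-> _]]//|[JK KJ']];
    apply/andP; split; apply/star_face_le.
exists (star_face (a |: J) b), (star_face (c |: J) b); split.
  move=> /star_face_eq[/setP/(_ a)]; rewrite !inE eqxx (negbTE ac) (negbTE aJ).
  by [].
apply/seteqP; split=> z; last first.
  move=> [->|->]; (split; first by rewrite star_face_rank cardsU1 ?aJ ?cJ; lia).
    by apply/le; rewrite subsetUr subUset sub1set aJ' JJ'.
  by apply/le; rewrite subsetUr subUset sub1set cJ' JJ'.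
move=> [rz /andP[xz zy]]; have [e|[K [d zE]]] := star_faceP z.
  by rewrite e in xz.
subst z; move: xz zy rz => /star_face_le[JK agK] /star_face_le[KJ' _].
rewrite star_face_rank => cK.
have zE : star_face K d = star_face K b.
  by apply/star_face_eq; split=> // k kK; rewrite agK.
rewrite zE; have /cards1P[k KD] : #|K :\: J| == 1%N.
  by rewrite cardsD (setIidPr JK); lia.
have KE : K = k |: J.
  rewrite -KD; apply/setP => l; rewrite !inE.
  by case: (boolP (l \in J)) => [/(subsetP JK) ->|lJ]; rewrite ?orbT ?orbF.
have kD : k \in J' :\: J.
  have /setDP[kK kJ] : k \in K :\: J by rewrite KD inE.
  by rewrite inE kJ (subsetP KJ').
move: kD; rewrite mem KE => /orP[]/eqP ->; [left|right]; reflexivity.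
Qed.

Lemma star_polytope : polytope q P.
Proof.
split.
- exact: ranked_mono (star_ranked q).
- apply/seteqP; split=> [_ [x _ <-]|i /= hi]; first exact: rank_bounds (star_ranked q) x.
  have [x _ rx] := star_flag_full (star_flagP 1 1) hi.
  by exists x.
- by exists None.
- by exists (star_face [set: 'I_q] 1); apply: star_largest.
- move=> Phi fPhi i /(star_flag_full fPhi)[x Px rx]; exists x; split=> // y [Py ry].
  by apply: (chain_rank_inj (star_ranked q) fPhi.1) => //; rewrite rx.
- exact: star_flag_connected.
- exact: star_diamond.
Qed.

Lemma star_act_flag a s p b :
  [set star_act a s x | x in star_flag p b]%classic =
  star_flag (p * s) ((hub_lift s)^-1 * b * a).
Proof.
apply/seteqP; split=> [_ [x [->|[k kq ->]] <-]|x [->|[k kq ->]]].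
- by left.
- by right; exists k => //; rewrite star_act_face imset_initial.
- by exists None; first left.
- exists (star_face (initial p k) b); first by right; exists k.
  by rewrite star_act_face imset_initial.
Qed.

Lemma star_regular : regular_polytope q P.
Proof.
split; first exact: star_polytope.
move=> _ _ /star_flag_exists[p [b ->]] /star_flag_exists[p' [b' ->]].
exists (star_act (b^-1 * hub_lift (p^-1 * p') * b') (p^-1 * p')).
by rewrite star_act_flag !mulgA mulgV mul1g mulgK mulVg mul1g.
Qed.

End StarConnected.

(** * Automorphism group, facets and vertex-figures *)

Section StarGroup.
Local Open Scope group_scope.
Variable q : nat.
Implicit Types (i j : 'I_q) (J : {set 'I_q}) (b : 'S_q.+1) (s p : 'S_q).
Notation leaf := (lift (@ord0 q)).
Notation P := (graphicahedron (star q)).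

Lemma star_act_inj a s a' s' : star_act a s = star_act a' s' -> a = a' /\ s = s'.
Proof.
move=> e; have act x : star_act a s x = star_act a' s' x by rewrite e.
have ss' : s = s'.
  apply/permP => j; have := act (star_face [set j] 1).
  rewrite !star_act_face => /star_face_eq[/setP/(_ (s j)) + _].
  by rewrite !imset_set1 !inE eqxx => /esym/eqP.
split=> //; have := act (star_face finset.set0 1).
rewrite !star_act_face ss' => /star_face_eq[_ agree].
apply: (mulgI ((hub_lift s')^-1 * 1)); apply: perm_leaf_eq => j; apply: agree.
by rewrite imset0 inE.
Qed.

Lemma star_act_surj (g : paut P) : exists a s, g = star_act a s.
Proof.
have f1 := star_flagP (1 : 'S_q) 1.
have [p [b e]] := star_flag_exists (image_flag (star_polytope q) g f1).
exists (hub_lift p * b), p; apply: (paut_eq_flag (star_polytope q) f1) => x.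
apply: (image_eq_app (star_polytope q) f1).
by rewrite e star_act_flag mul1g mulg1 mulKg.
Qed.

Lemma star_act_decomposition : exists dec : paut P -> 'S_q.+1 * 'S_q,
  [/\ {morph dec : g h / g * h}, forall a s, dec (star_act a s) = (a, s)
    & forall g, star_act (dec g).1 (dec g).2 = g].
Proof.
have /choice[dec decE] (g : paut P) : exists x : 'S_q.+1 * 'S_q, star_act x.1 x.2 = g.
  by have [a [s ->]] := star_act_surj g; exists (a, s).
have decK a s : dec (star_act a s) = (a, s).
  have /star_act_inj[ea es] := decE (star_act a s).
  by rewrite [LHS]surjective_pairing ea es.
exists dec; split=> // g h.
by rewrite -{1}(decE g) -{1}(decE h) -star_actM decK.
Qed.

Lemma star_group_iso : group_iso (paut P) ('S_q.+1 * 'S_q)%type.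
Proof.
have [dec [decM decK decE]] := star_act_decomposition.
have [f fE] := multiplicative_exists decM; exists f.
exists (fun x => star_act x.1 x.2) => [g|[a s]]; first by rewrite fE decE.
by rewrite fE decK.
Qed.

Definition ord_prev (i : 'I_q) : 'I_q :=
  Ordinal (leq_ltn_trans (leq_pred i) (ltn_ord i)).

(** The automorphism of index 0 changes the vertex of the base flag along its first
    leaf; the one of index i > 0 swaps the leaves i - 1 and i in the order.  In
    the latter case the vertex is kept, hence the factor in S_(q+1). *)
Definition star_gen (i : 'I_q) : paut P :=
  if i == 0%N :> nat then star_act (startr i) 1
  else star_act (hub_lift (tperm (ord_prev i) i)) (tperm (ord_prev i) i).

Lemma star_gen_flag i : [set star_gen i x | x in star_flag 1 1]%classic =
  if i == 0%N :> nat then star_flag 1 (startr i) else star_flag (tperm (ord_prev i) i) 1.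
Proof.
rewrite /star_gen; case: eqP => _; rewrite star_act_flag mul1g mulg1.
  by rewrite hub_lift1 invg1 mul1g.
by rewrite mulVg.
Qed.

Lemma star_gen_distinguished : distinguished_generators (star_flag 1 1) star_gen.
Proof.
move=> i; rewrite star_gen_flag; have iq := ltn_ord i; case: eqP => [i0|i0].
  rewrite i0; apply: star_flag_adjacent_at => //.
    move=> /star_face_eq[_ /(_ i)]; rewrite mem_initial ltn0 => /(_ isT).
    by rewrite perm1 tpermR => /eqP; rewrite leaf_neq0.
  move=> l lq l0; apply/star_face_eq; split=> // j; rewrite mem_initial invg1 !perm1 => jl.
  rewrite /startr tpermD ?neq_lift // (inj_eq lift_inj).
  by apply: contraNneq jl => <-; rewrite i0 lt0n.
have ii : i = (ord_prev i).+1 :> nat by rewrite /=; lia.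
apply: star_flag_adjacent_at => [|e|l lq li]; first exact: ltnW.
  have := e; rewrite {1}ii {1}[in RHS]ii => /star_face_eq[/setP/(_ (ord_prev i))].
  by rewrite !mem_initial tpermV invg1 perm1 tpermL -ii ltnn /=; lia.
by rewrite -[tperm _ _]mulg1 initial_eq_swap // -ii.
Qed.

End StarGroup.

Lemma poset_iso_embedding d d' (T : porderType d) (F : porderType d') (x y : T)
    (iota : F -> T) : {mono iota : u v / (u <= v)%O} ->
  (forall z, (x <= z <= y)%O <-> exists u, z = iota u) -> poset_iso (psection x y) F.
Proof.
move=> imono image.
have /choice[f fE] (z : psection x y) : exists u, val z = iota u.
  by apply/image; apply: (valP z).
have iP u : (x <= iota u <= y)%O by apply/image; exists u.
exists f; split.
  exists (fun u => exist _ (iota u) (iP u)) => [z|u]; first exact/val_inj/esym/fE.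
  by apply/le_anti; rewrite -!imono -!fE /= lexx.
by move=> z w; rewrite -imono -!fE.
Qed.

(** The map f is determined by the images of the singletons, which are singletons;
    and the singleton of i is pinned down by two consecutive initial sets. *)
Lemma boolean_rigid m n (h : 'I_m -> 'I_n) (f : {set 'I_m} -> {set 'I_n}) :
  injective h -> {mono f : A B / A \subset B} -> (forall A, #|f A| = #|A|) ->
  (forall k, (k <= m)%N -> f (initial 1%g k) = h @: initial 1%g k) ->
  forall A, f A = h @: A.
Proof.
move=> hinj fmono fcard finit A.
have /choice[g gE] (i : 'I_m) : exists j, f [set i] = [set j].
  by apply/cards1P; rewrite fcard cards1.
have memf i B : (g i \in f B) = (i \in B) by rewrite -!sub1set -gE fmono.
have gh i : g i = h i.
  have : g i \in f (initial 1%g i.+1) by rewrite memf mem_initial invg1 perm1.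
  rewrite finit // => /imsetP[j]; rewrite mem_initial invg1 perm1 => ji gj.
  have : g i \notin f (initial 1%g i) by rewrite memf mem_initial invg1 perm1 ltnn.
  rewrite finit; last exact: ltnW.
  rewrite gj (mem_imset _ _ hinj) mem_initial invg1 perm1 => ij.
  by congr h; apply: val_inj => /=; lia.
apply/esym/eqP; rewrite eqEcard fcard card_imset // leqnn andbT.
by apply/subsetP => _ /imsetP[i iA ->]; rewrite -gh memf.
Qed.

Section Simplex.
Local Open Scope group_scope.
Variable n : nat.
Notation V := (simplex n).

Lemma simplex_leE (A B : V) : (A <= B)%O = ((A : {set 'I_n.+1}) \subset B).
Proof. exact: Order.SetSubsetOrder.leEsubset. Qed.

Lemma simplex_rankE (A : V) : rank A = (#|(A : {set 'I_n.+1})|%:Z - 1)%R.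
Proof. by []. Qed.

Lemma simplex_graded : graded V.
Proof.
split=> [A B|A|A].
- by rewrite lt_neqAle simplex_leE !simplex_rankE -finset.properEneq => /proper_card; lia.
- by rewrite simplex_rankE; lia.
rewrite simplex_rankE => A0.
have /card_gt0P[j jA] : (0 < #|(A : {set 'I_n.+1})|)%N by lia.
have cA := cardsD1 j A; rewrite jA in cA.
exists ((A : {set 'I_n.+1}) :\ j : V); last by rewrite simplex_rankE; lia.
by rewrite lt_neqAle simplex_leE -finset.properEneq properD1.
Qed.

Lemma simplex_rigid (g : paut V) :
  (forall k, (k <= n.+1)%N -> g (initial 1 k : V) = initial 1 k) -> g = 1.
Proof.
move=> fix_g; apply: pautP => A; rewrite paut1_app -[RHS]imset_id.
pose f (A : {set 'I_n.+1}) : {set 'I_n.+1} := g (A : V).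
apply: (@boolean_rigid _ _ id f) => // [B C|B|k kn].
- by rewrite -!simplex_leE paut_le.
- by have := graded_paut_rank simplex_graded g (B : V); rewrite !simplex_rankE /f; lia.
- by rewrite imset_id; apply: fix_g.
Qed.

Definition simplex_act_fun (s : 'S_n.+1) (A : V) : V := s @: (A : {set 'I_n.+1}).

Lemma simplex_act_funK s : cancel (simplex_act_fun s) (simplex_act_fun s^-1).
Proof.
move=> A; rewrite /simplex_act_fun -imset_comp -[RHS]imset_id.
by apply: eq_imset => j /=; rewrite permK.
Qed.

Lemma simplex_act_funVK s : cancel (simplex_act_fun s^-1) (simplex_act_fun s).
Proof. by move=> A; rewrite -{2}(simplex_act_funK s^-1 A) invgK. Qed.

Lemma simplex_act_fun_homo s : {homo simplex_act_fun s : A B / (A <= B)%O}.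
Proof. by move=> A B; rewrite !simplex_leE; apply: imsetS. Qed.

Definition simplex_act s : paut V :=
  PAut (@simplex_act_funK s) (@simplex_act_funVK s)
    (@simplex_act_fun_homo s) (@simplex_act_fun_homo s^-1).

Lemma simplex_actE s (A : V) : simplex_act s A = s @: (A : {set 'I_n.+1}).
Proof. by []. Qed.

Lemma simplex_actM s t : simplex_act (s * t) = simplex_act s * simplex_act t.
Proof.
apply: pautP => A; rewrite pautM_app !simplex_actE -imset_comp.
by apply: eq_imset => j; rewrite permM.
Qed.


Definition vertex_face (A : V) : graphicahedron (star n.+1) :=
  star_face (A : {set 'I_n.+1}) 1.

Lemma vertex_face_embedding :
  section_embedding (star_face finset.set0 1) (star_face [set: 'I_n.+1] 1) vertex_face.
Proof.
split=> [A B|z|A].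
- by rewrite simplex_leE; apply/idP/idP => [/star_face_le[]|AB]; last exact/star_face_le.
- split=> [/andP[xz _]|[A ->]]; last first.
    by apply/andP; split; apply/star_face_le; rewrite ?sub0set ?subsetT; split.
  have [e|[J [b e]]] := star_faceP z; first by rewrite e in xz.
  rewrite e in xz *; move: xz => /star_face_le[_ agree].
  by exists (J : V); apply/star_face_eq; split=> // j /agree.
- by rewrite !star_face_rank cards0 simplex_rankE; lia.
Qed.

Definition simplex_flag (p : 'S_n.+1) : set V :=
  [set A : V | exists2 k, (k <= n.+1)%N & A = initial p k]%classic.

(** A flag of the simplex becomes a flag of the star graphicahedron when the
    smallest face is added, so that [star_flag_exists] applies. *)
Lemma simplex_flag_exists (G : set V) : flag G -> exists p, G = simplex_flag p.
Proof.
move=> fG; have emb := vertex_face_embedding.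
pose Phi : set (graphicahedron (star n.+1)) :=
  ([set x | x = None \/ exists2 A, G A & x = vertex_face A])%classic.
have G0 : G (finset.set0 : V).
  by apply: (smallest_flag fG) => A; rewrite simplex_leE sub0set.
have fPhi : flag Phi.
  split=> [x y [->|[A GA ->]] [->|[B GB ->]]|H cH sub]; [by left|by left|by right| |].
    by rewrite !(embedding_le emb); apply: fG.1.
  apply/seteqP; split=> // x Hx.
  have [->|[J [b xE]]] := star_faceP x; first by left.
  have [A xA] : exists A, x = vertex_face A.
    apply/(embedding_image emb); apply/andP; split; last exact: star_largest.
    have H0 : H (star_face finset.set0 1).
      by apply: sub; right; exists (finset.set0 : V).
    have [//|] := cH _ _ H0 Hx.
    rewrite xE => le; have /star_face_le[/[!subset0] /eqP J0 agree] := le.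
    by apply/star_face_le; split=> [|j jJ]; rewrite ?sub0set // -agree // inE.
  right; exists A => //; rewrite -(fG.2 (preimage vertex_face H)) ?xA //=.
  - by rewrite -xA.
  - by move=> B C HB HC; rewrite -!(embedding_le emb); apply: cH.
  - by move=> B GB; apply: sub; right; exists B.
have [p [b e]] := star_flag_exists fPhi; exists p.
apply: flag_ext fG _ _ => [A B [k _ ->] [l _ ->]|A GA].
  by case: (leqP k l) => [kl|/ltnW lk]; [left|right]; rewrite simplex_leE initial_sub.
have : Phi (vertex_face A) by right; exists A.
by rewrite e => -[//|[k kn /star_face_eq[-> _]]]; exists k.
Qed.

End Simplex.

(** The base facet of the graphicahedron of K_{1,n+1} consists of the faces
    (J, b) where J avoids the last leaf and b fixes it; forgetting this leaf
    gives the graphicahedron of K_{1,n}. *)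
Section FacetEmbedding.
Local Open Scope group_scope.
Variable n : nat.
Notation leaf m := (lift (@ord0 m)).

(** The new leaf gets the largest number, so that the centre remains 0. *)
Definition widen_perm (b : 'S_n.+1) : 'S_n.+2 := lift_perm ord_max ord_max b.

Lemma widen_leaf (j : 'I_n) :
  leaf n.+1 (lift ord_max j) = lift ord_max (leaf n j).
Proof.
apply: val_inj; rewrite /= /bump leq0n !add1n [(n <= j)%N]leqNgt ltn_ord.
by rewrite [(n.+1 <= _)%N]leqNgt !ltnS ltn_ord.
Qed.

Lemma leaf_max : leaf n.+1 ord_max = ord_max.
Proof. by apply: val_inj. Qed.

Lemma widen_perm_leaf b (j : 'I_n) :
  widen_perm b (leaf n.+1 (lift ord_max j)) = lift ord_max (b (leaf n j)).
Proof. by rewrite widen_leaf /widen_perm lift_perm_lift. Qed.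

Lemma widen_perm_max b : widen_perm b (leaf n.+1 ord_max) = leaf n.+1 ord_max.
Proof. by rewrite leaf_max /widen_perm lift_perm_id. Qed.

Lemma widen_perm_exists (b : 'S_n.+2) : b ord_max = ord_max ->
  exists c, b = widen_perm c.
Proof.
move=> bmax; have /choice[f fE] (i : 'I_n.+1) :
    exists j, b (lift ord_max i) = lift ord_max j.
  have [j ->|e] := unliftP ord_max (b (lift ord_max i)); first by exists j.
  have := neq_lift ord_max i; rewrite -(inj_eq (@perm_inj _ b)) e bmax.
  by rewrite eqxx.
have finj : injective f.
  by move=> i j e; have := fE i; rewrite e -fE => /perm_inj/lift_inj.
exists (perm finj); apply/permP => x; rewrite /widen_perm.
have [j ->|->] := unliftP ord_max x; last by rewrite lift_perm_id.
by rewrite lift_perm_lift permE fE.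
Qed.

Definition facet_face (x : graphicahedron (star n)) : graphicahedron (star n.+1) :=
  if x is Some u then
    star_face (lift ord_max @: star_support u) (widen_perm (val (gclass_repr u)).2)
  else None.

Lemma widen_agree (b c : 'S_n.+1) (J : {set 'I_n}) :
  (forall j, j \notin J -> b (leaf n j) = c (leaf n j)) <->
  (forall j, j \notin lift ord_max @: J ->
     widen_perm b (leaf n.+1 j) = widen_perm c (leaf n.+1 j)).
Proof.
split=> agree j jJ.
  have [k jE|->] := unliftP ord_max j; last by rewrite !widen_perm_max.
  rewrite jE !widen_perm_leaf agree //; apply: contra jJ => kJ.
  by rewrite jE imset_f.
apply: (@lift_inj _ ord_max); rewrite -!widen_perm_leaf; apply: agree.
by apply: contra jJ => /imsetP[k kJ /lift_inj ->].
Qed.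

Lemma facet_faceE J b :
  facet_face (star_face J b) = star_face (lift ord_max @: J) (widen_perm b).
Proof.
have [JE e] := gclass_repr_star J b.
rewrite /facet_face {1}/star_face JE; apply/star_face_eq; split=> //; exact/widen_agree.
Qed.

Lemma facet_face_embedding :
  section_embedding (None : graphicahedron (star n.+1))
    (star_face (initial 1 n) 1) facet_face.
Proof.
have iniE : initial 1 n = lift ord_max @: [set: 'I_n].
  apply/setP => j; rewrite mem_initial invg1 perm1; apply/idP/imsetP => [jn|[k _ ->]].
    by exists (Ordinal jn); rewrite ?inE //; apply: val_inj; rewrite /= /bump leqNgt jn.
  by rewrite /= /bump [(n <= k)%N]leqNgt ltn_ord add0n ltn_ord.
have one : widen_perm 1 = 1 by apply: lift_perm1.
split=> [x y|z|x].
- have [->|[J [b ->]]] := star_faceP x; first by [].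
  have [->|[K [c ->]]] := star_faceP y; first by rewrite facet_faceE.
  rewrite !facet_faceE; apply/idP/idP => /star_face_le[JK agree]; apply/star_face_le.
    split; last exact/widen_agree.
    apply/subsetP => j jJ; have /imsetP[k kK /lift_inj -> //] :
      lift ord_max j \in lift ord_max @: K.
    by apply: (subsetP JK); apply: imset_f.
  by split; [apply: imsetS | apply/widen_agree].
- split=> [/andP[_ zy]|[x ->]].
    have [->|[J [b zE]]] := star_faceP z; first by exists None.
    rewrite {}zE in zy *; move: zy => /star_face_le[]; rewrite iniE => JT agree.
    have [|c bE] := @widen_perm_exists b.
      rewrite -leaf_max agree ?perm1 //; apply/imsetP => -[k _ e].
      by have := neq_lift ord_max k; rewrite -e eqxx.
    exists (star_face (lift ord_max @^-1: J) c); rewrite facet_faceE -bE; congr star_face.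
    apply/setP => j; apply/idP/imsetP => [jJ|[k]]; last by rewrite inE => + ->.
    have /imsetP[k _ jE] := subsetP JT _ jJ; exists k => //.
    by rewrite inE -jE.
  have [->//|[J [b ->]]] := star_faceP x; rewrite facet_faceE; apply/andP; split=> //.
  apply/star_face_le; rewrite iniE; split; first by rewrite imsetS ?subsetT.
  by rewrite -one; apply/widen_agree => j; rewrite inE.
have [->|[J [b ->]]] := star_faceP x; first by rewrite star_rank_bottom.
have cJ : #|lift ord_max @: J| = #|J| by rewrite card_imset //; apply: lift_inj.
by rewrite facet_faceE !star_face_rank star_rank_bottom cJ; lia.
Qed.

Lemma star_has_facets : has_facets n.+1 (graphicahedron (star n.+1)) (graphicahedron (star n)).
Proof.
move=> x y sx ry; have regP := star_regular n.+1; have hP := regP.1.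
have [G fG Gy] := face_in_flag y.
have [g gG] := regP.2 _ _ (star_flagP 1 1) fG.
move: Gy; rewrite -gG => -[y' Fy' gy].
have yE : y = g (star_face (initial 1 n) 1).
  rewrite -gy; congr (g _); apply: (chain_rank_inj hP (star_flagP 1 1).1) => //.
    exact: star_flag_mem.
  by rewrite -(paut_rank hP g) gy ry star_face_rank card_initial //; lia.
have xE : x = g None by rewrite paut_smallest //; apply/le_anti; rewrite sx.
have emb := facet_face_embedding.
apply: (@poset_iso_embedding _ _ _ _ _ _ (g \o facet_face)).
  by move=> u v; apply: etrans (paut_le g _ _) (embedding_le emb u v).
move=> z; rewrite yE xE -(pautVK g z); set w := (g^-1)%g z.
rewrite !paut_le; split=> [/(embedding_image emb)[u ->]|[u]]; first by exists u.
move=> /(can_inj (pautKV g)) ->; apply/(embedding_image emb); by exists u.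
Qed.

Lemma star_has_vertex_figures :
  has_vertex_figures (graphicahedron (star n.+1)) (simplex n).
Proof.
move=> x y rx ly; have [e|[J [b xE]]] := star_faceP x; first by rewrite e in rx.
have J0 : J = finset.set0.
  by apply/eqP; rewrite -cards_eq0; move: rx; rewrite xE star_face_rank; lia.
apply: (@poset_iso_embedding _ _ _ _ _ _
   (fun A : simplex n => star_face (A : {set 'I_n.+1}) b)).
  by move=> A B; rewrite simplex_leE; apply/idP/idP => [/star_face_le[]|AB] //; apply/star_face_le.
move=> z; rewrite xE J0; split=> [/andP[xz _]|[A ->]].
  have [e|[K [c e]]] := star_faceP z; first by rewrite e in xz.
  rewrite e in xz *; move: xz => /star_face_le[_ agree].
  by exists (K : simplex n); apply/star_face_eq; split=> // j /agree.
by rewrite ly andbT; apply/star_face_le; split; rewrite ?sub0set.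
Qed.

End FacetEmbedding.

(** * Automorphisms that move one face of the base flag *)

Section Generators.
Local Open Scope order_scope.
Local Open Scope classical_set_scope.
Variables (n : nat) (P : rposet) (Phi : set P).
Hypotheses (hP : polytope n P) (fPhi : flag Phi).
Implicit Types (j k : int) (g h : paut P) (x y z : P).

Definition fixes_off g j : Prop := forall z, Phi z -> rank z <> j -> g z = z.

Lemma adjacent_image g j z : Phi z -> rank z = j -> g z <> z -> fixes_off g j ->
  adjacent_at j Phi [set g x | x in Phi].
Proof.
move=> Pz rz gz fix_g; split=> [e|x rx].
  apply: gz; apply: (chain_rank_inj hP fPhi.1) => //; last exact: (paut_rank hP).
  by rewrite e; exists z.
split=> [Px|[y Py yx]]; first by exists x => //; apply: fix_g.
by rewrite -yx (fix_g y Py) // -(paut_rank hP g) yx.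
Qed.

(** Unless g fixes z, both g z and h (g z) lie between the neighbours of z in the
    flag and differ from z. *)
Lemma fixes_moved g h j k z : (0 <= j < n%:Z)%R -> fixes_off g j -> fixes_off h k ->
  (k <> j -> k <> j - 1 -> k <> j + 1 -> Phi z -> rank z = j -> h (g z) = g z)%R.
Proof.
move=> jn fix_g fix_h kj kj1 kj2 Pz rz.
have [gz|gz] := pselect (g z = z); first by rewrite gz fix_h // rz => /esym.
have [|x Px rx] := @flag_face _ _ hP Phi (j - 1)%R fPhi; first by lia.
have [|y Py ry] := @flag_face _ _ hP Phi (j + 1)%R fPhi; first by lia.
have xzy : x <= z <= y.
  by apply/andP; split; apply: (chain_rank_le hP fPhi.1) => //; lia.
have gx : g x = x by apply: fix_g => //; lia.
have gy : g y = y by apply: fix_g => //; lia.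
have hx : h x = x by apply: fix_h => //; lia.
have hy : h y = y by apply: fix_h => //; lia.
have hz : h z = z by apply: fix_h => //; lia.
have xgy : x <= g z <= y by rewrite -{1}gx -{1}gy !paut_le.
apply: (diamond_unique hP rx ry _ xgy xzy); rewrite ?(paut_rank hP) //.
- by rewrite -{1}hx -{1}hy !paut_le.
- by rewrite -{2}hz => /(can_inj (pautKV h)).
Qed.

Lemma generators_commute g h j k : (0 <= j < n%:Z)%R -> (0 <= k < n%:Z)%R ->
  (j + 2 <= k)%R -> fixes_off g j -> fixes_off h k -> (g * h = h * g)%g.
Proof.
move=> jn kn jk fix_g fix_h; apply: (paut_eq_flag hP fPhi) => z Pz.
rewrite !pautM_app; have [rz|rz] := pselect (rank z = j).
  rewrite (fixes_moved jn fix_g fix_h _ _ _ Pz rz); try lia.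
  by rewrite (fix_h z) //; lia.
rewrite (fix_g z) //; have [rz'|rz'] := pselect (rank z = k).
  by rewrite (fixes_moved kn fix_h fix_g _ _ _ Pz rz') //; lia.
by rewrite (fix_h z) // (fix_g z).
Qed.

Lemma distinguished_unique (rho rho' : 'I_n -> paut P) :
  distinguished_generators Phi rho -> distinguished_generators Phi rho' ->
  forall i, rho i = rho' i.
Proof.
move=> d d' i; apply: (paut_eq_flag hP fPhi) => x; apply: (image_eq_app hP fPhi).
by apply: (adjacent_unique hP fPhi _ _ (d i) (d' i)); apply: (image_flag hP).
Qed.

Lemma distinguished_conj (a : paut P) (rho : 'I_n -> paut P) :
  distinguished_generators [set a x | x in Phi] rho ->
  distinguished_generators Phi (fun i => a * rho i * a^-1)%g.
Proof.
move=> d i; have [ne ag] := d i.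
split=> [e|x rx].
  apply: ne; apply/seteqP; split=> [_ [x Px <-]|_ [_ [x Px <-] <-]].
    move: Px; rewrite {1}e => -[y Py <-].
    by exists (a y); [exists y | rewrite !pautM_app pautVK].
  exists (a^-1 (rho i (a x)))%g; last by rewrite pautVK.
  by rewrite e; exists x.
have rax : rank (a x) <> i%:Z%R by rewrite (paut_rank hP).
have agx := ag _ rax; split=> [Px|[y Py yx]].
  have [_ [y Py <-] e] : [set rho i z | z in [set a y | y in Phi]] (a x).
    by apply/agx; exists x.
  by exists y => //; rewrite !pautM_app e pautKV.
have [z Pz /(can_inj (pautKV a)) <- //] : [set a y | y in Phi] (a x).
apply/agx; exists (a y); first by exists y.
by rewrite -yx !pautM_app pautVK.
Qed.

End Generators.

(** * Amalgamating the groups of the facets and of the vertex-figures *)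

(** In the group L of a polytope whose facets are graphicahedra of K_{1,n}, psi
    is the image of the group of a facet and theta that of a vertex-figure; tau
    is the generator of rank 0.  Writing n = m + 3 expresses that a facet has at
    least three leaves. *)
Section StarMorphism.
Local Open Scope group_scope.

Lemma star_relations_morph (G H : groupType) (f : G -> H) q (t : 'I_q -> G) :
  {morph f : x y / x * y} -> star_relations t -> star_relations (f \o t).
Proof.
move=> fM [t2 tb tc]; split=> [i|i j ij|i j k ij ik jk] /=.
- by rewrite -fM t2 multiplicative1.
- by rewrite -!fM tb.
- by rewrite /commute -!fM; congr f; apply: tc.
Qed.

Lemma startr_conj q (s : 'S_q) i : startr i ^ hub_lift s = startr (s i).
Proof. by rewrite /startr tpermJ hub_lift_leaf hub_lift0. Qed.

Lemma widen_tperm n (i j : 'I_n.+1) :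
  widen_perm (tperm i j) = tperm (lift ord_max i) (lift ord_max j).
Proof.
apply/permP => x; rewrite /widen_perm; have [k ->|->] := unliftP ord_max x.
  rewrite lift_perm_lift; have inj := @lift_inj _ (@ord_max n.+1).
  case: (tpermP i j k) => [->|->|/eqP ki /eqP kj]; rewrite ?tpermL ?tpermR //.
  by rewrite tpermD // (inj_eq inj) eq_sym.
by rewrite lift_perm_id tpermD // eq_sym neq_lift.
Qed.

Variables (m : nat) (L : groupType).
Let n := m.+3.
Variables (psi : 'S_n.+1 -> 'S_n -> L) (theta : 'S_n.+1 -> L).
Hypothesis psiM : forall a s a' s', psi (a * a') (s * s') = psi a s * psi a' s'.
Hypothesis thetaM : {morph theta : x y / x * y}.
Hypothesis agree : forall s : 'S_n, psi (hub_lift s) s = theta (widen_perm s).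

Let last : 'I_n.+1 := ord_max.
Let prev : 'I_n.+1 := lift ord_max (ord_max : 'I_n).
Let tau := psi (startr (ord0 : 'I_n)) 1.
Hypothesis commute_last : commute tau (theta (tperm prev last)).

Let zero : 'I_n.+1 := ord0.

Let zeroE : zero = lift ord_max (ord0 : 'I_n). Proof. exact: val_inj. Qed.

Let theta1 : theta 1 = 1 := multiplicative1 thetaM.
Let thetaV : {morph theta : x / x^-1} := multiplicativeV thetaM.
Let thetaJ x y : theta (x ^ y) = theta x ^ theta y.
Proof. by rewrite !conjgE !thetaM thetaV. Qed.

Let psi_trM : {morph (fun a => psi a 1) : x y / x * y}.
Proof. by move=> x y; rewrite -psiM mulg1. Qed.

Let psi_startr_conj (j : 'I_n) (s : 'S_n) :
  psi (startr j) 1 ^ theta (widen_perm s) = psi (startr (s j)) 1.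
Proof.
rewrite -agree -startr_conj conjgE [in RHS]conjgE.
apply: (mulgI (psi (hub_lift s) s)); rewrite mulKVg -!psiM mulKVg.
by rewrite !mulg1 mul1g.
Qed.

Let commute_tau_widen (s : 'S_n) : s ord0 = ord0 -> commute tau (theta (widen_perm s)).
Proof.
move=> s0; apply/commgP/conjg_fixP.
by rewrite psi_startr_conj s0.
Qed.

Let commute_tau_tperm (c : 'I_n.+1) : c != zero -> commute tau (theta (tperm c last)).
Proof.
move=> c0; have [->|cl] := eqVneq c last; first by rewrite tperm1 theta1; apply: commute1.
have [k cE|cE] := unliftP last c; last by rewrite cE eqxx in cl.
have k0 : k != ord0 by apply: contraNneq c0 => k0; rewrite cE k0 zeroE.
have -> : tperm c last = tperm prev last ^ tperm prev c.
  rewrite tpermJ tpermL [tperm _ _ last]tpermD // /prev /last eq_sym neq_lift //.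
rewrite thetaJ conjgE.
have cpc : commute tau (theta (tperm prev c)).
  rewrite cE /prev -widen_tperm; apply: commute_tau_widen; rewrite tpermD // eq_sym //.
by apply: commuteM; [apply: commuteV|apply: commuteM].
Qed.

Let commute_tau (w : 'S_n.+1) : w zero = zero -> commute tau (theta w).
Proof.
move=> w0; have wl0 : w last != zero by rewrite -w0 (inj_eq perm_inj).
have [|s sE] := @widen_perm_exists _ (w * tperm (w last) last).
  by rewrite permM tpermL.
have -> : w = widen_perm s * tperm (w last) last by rewrite -sE -mulgA tperm2 mulg1.
rewrite thetaM; apply: commuteM; last exact: commute_tau_tperm.
apply: commute_tau_widen; apply: (@lift_inj _ ord_max).
have := congr1 (fun p : 'S_n.+1 => p zero) sE.
rewrite permM w0 tpermD ?(eq_sym _ zero) //; last by rewrite eq_sym.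
by rewrite {2}zeroE /widen_perm lift_perm_lift => <-; rewrite zeroE.
Qed.

(** The element of L that must be the image of the transposition of 0 and the
    i-th leaf. *)
Definition spread_tr (i : 'I_n.+1) : L := tau ^ theta (tperm zero i).

(** This amounts to tau commuting with theta w for each w that fixes the first leaf;
    such w are products of permutations within the facet and of conjugates of
    the last transposition. *)
Lemma spread_trJ i (w : 'S_n.+1) : spread_tr i ^ theta w = spread_tr (w i).
Proof.
rewrite /spread_tr -conjgM -thetaM.
apply: (conjg_inj (theta (tperm zero (w i)))^-1); rewrite conjgK -conjgM -thetaV -thetaM.
apply/conjg_fixP/commgP; apply: commute_tau.
by rewrite !permM tpermL tpermV tpermR.
Qed.

Lemma spread_tr_widen (j : 'I_n) : spread_tr (lift ord_max j) = psi (startr j) 1.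
Proof. by rewrite /spread_tr zeroE -widen_tperm psi_startr_conj tpermL. Qed.

Lemma spread_tr0 : spread_tr zero = tau.
Proof. by rewrite /spread_tr tperm1 theta1 conjg1. Qed.

Let avoid (i j k : 'I_n.+1) : exists x : 'I_n.+1, [/\ x != i, x != j & x != k].
Proof.
apply: contrapT => none; have sub : {subset enum 'I_n.+1 <= [:: i; j; k]}.
  move=> x _; apply: contraT => xn; case: none; exists x.
  by move: xn; rewrite !inE !negb_or => /and3P[].
by have := uniq_leq_size (enum_uniq _) sub; rewrite size_enum_ord.
Qed.

(** A relation involves at most three leaves.  As there are n + 1 >= 4 of them,
    swapping the last one with a leaf that does not occur moves the relation
    into the facet. *)
Lemma spread_relations : star_relations spread_tr.
Proof.
(* Only these two properties of the elements t i are used from here on. *)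
move: spread_trJ spread_tr_widen; move: spread_tr => t tJ tW.
have [p2 pb pc] := star_relations_morph psi_trM (startr_relations n).
have reduce i j k : exists (w : 'S_n.+1) (i' j' k' : 'I_n),
    [/\ w i = lift ord_max i', w j = lift ord_max j' & w k = lift ord_max k'].
  have [x [xi xj xk]] := avoid i j k; exists (tperm x last).
  have low y : x != y -> exists y', tperm x last y = lift ord_max y'.
    move=> xy; have [y' ->|e] := unliftP ord_max (tperm x last y); first by exists y'.
    by move: e xy; rewrite -[ord_max](tpermL x last) => /perm_inj ->; rewrite eqxx.
  have [[i' ->] [j' ->]] := (low i xi, low j xj).
  by have [k' ->] := low k xk; exists i', j', k'.
have inj (w : 'S_n.+1) a b a' b' : w a = lift ord_max a' -> w b = lift ord_max b' ->
    a != b -> a' != b'.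
  by move=> wa wb; apply: contraNneq => ab; rewrite -(inj_eq (@perm_inj _ w)) wa wb ab.
split=> [i|i j ij|i j k ij ik jk].
- have [w [i' [_ [_ [wi _ _]]]]] := reduce i i i.
  apply: (conjg_inj (theta w)); rewrite conjMg conj1g tJ wi tW.
  exact: p2.
- have [w [i' [j' [_ [wi wj _]]]]] := reduce i j j.
  apply: (conjg_inj (theta w)); rewrite !conjMg !tJ wi wj !tW.
  by apply: pb; apply: inj wi wj ij.
have [w [i' [j' [k' [wi wj wk]]]]] := reduce i j k.
apply: (conjg_inj (theta w)); rewrite !conjMg !tJ wi wj wk !tW.
by apply: pc; [apply: inj wi wj ij|apply: inj wi wk ik|apply: inj wj wk jk].
Qed.

(** The relabelling by s is a right translation times an element that fixes the
    base vertex, namely (a, s) = (a s'^-1, 1)(s', s) with s' the lift of s; this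
    dictates the formula for f. *)
Lemma star_group_morphism : exists f : 'S_n.+2 -> 'S_n.+1 -> L,
  [/\ forall a s a' s', f (a * a') (s * s') = f a s * f a' s',
      f (startr zero) 1 = tau
    & forall s, f (hub_lift s) s = theta s].
Proof.
have [phi [phiM phiE]] := star_presentation spread_relations.
have phi1 := multiplicative1 phiM.
have phiJ a s : phi a ^ theta s = phi (a ^ hub_lift s).
  elim/star_perm_ind: a => [|a i IHa]; first by rewrite phi1 !conj1g phi1.
  by rewrite phiM !conjMg phiM IHa !phiE spread_trJ startr_conj phiE.
exists (fun a s => phi (a * (hub_lift s)^-1) * theta s); split=> [a s a' s'||s].
- rewrite thetaM hub_liftM invMg.
  have -> : a * a' * ((hub_lift s')^-1 * (hub_lift s)^-1) =
      (a * (hub_lift s)^-1) * (a' * (hub_lift s')^-1) ^ (hub_lift s)^-1.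
    by rewrite conjgE invgK !mulgA mulgKV.
  rewrite phiM -!mulgA; congr (_ * _); rewrite -(hub_liftV s) -phiJ conjgE thetaV invgK.
  by rewrite !mulgA mulgKV.
- by rewrite hub_lift1 invg1 mulg1 theta1 mulg1 phiE spread_tr0.
- by rewrite mulgV phi1 mul1g.
Qed.

End StarMorphism.

(** * Universality *)

Lemma section_embedding_comp (Q F : rposet) (x y : Q) (iota : F -> Q) (g : paut F) :
  graded F -> section_embedding x y iota -> section_embedding x y (iota \o g).
Proof.
move=> gF emb; split=> [u v|z|u] /=.
- by rewrite (embedding_le emb) paut_le.
- split=> [/(embedding_image emb)[u ->]|[u ->]].
    by exists (g^-1 u)%g; rewrite pautVK.
  by apply/(embedding_image emb); exists (g u).
- by rewrite (embedding_rank emb) graded_paut_rank.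
Qed.

Section Universality.
Local Open Scope order_scope.
Variables (m : nat) (Q : rposet) (Psi : set Q).
Let n := m.+3.
Let P := graphicahedron (star n.+1).
Let F := graphicahedron (star n).
Let V := simplex n.
Hypotheses (regQ : regular_polytope n.+1 Q) (fPsi : flag Psi).
Hypotheses (facetsQ : has_facets n.+1 Q F) (figuresQ : has_vertex_figures Q V).

Let hQ := regQ.1.
Let gF : graded F := polytope_graded (star_polytope n).
Let gV : graded V := @simplex_graded n.

(** As the models are flag-transitive, the identification can be chosen to carry
    the base flag of the model to the given flag; likewise for [based_figure]. *)
Lemma based_facet : exists x y (iota : F -> Q),
  [/\ smallest_face x, Psi y, rank y = (n%:Z)%R, section_embedding x y iota &
      forall u, Psi (iota u) <-> star_flag 1%g 1%g u].
Proof.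
have [x sx] := ex_smallest hQ.
have [|y Py ry] := @flag_face _ _ hQ Psi (n%:Z)%R fPsi; first by lia.
have ry' : rank y = (n.+1%:Z - 1)%R by lia.
have [iota emb] := section_embedding_exists hQ gF (facetsQ sx ry').
have outside z : Psi z -> [\/ exists u, z = iota u, smallest_face z | largest_face z].
  move=> Pz; have [zy|yz] := leP (rank z) (n%:Z)%R.
    apply: Or31; apply/(embedding_image emb); rewrite sx.
    by apply: (chain_rank_le hQ fPsi.1) => //; rewrite ry.
  by apply/Or33/(largest_rank hQ); have := rank_bounds hQ z; lia.
have [g gG] := (star_regular n).2 _ _ (star_flagP 1%g 1%g) (preimage_flag emb fPsi outside).
exists x, y, (iota \o g); split=> //; first exact: section_embedding_comp.
move=> u; have E v : Psi (iota v) <-> [set u | Psi (iota u)]%classic v by [].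
apply: (iff_trans (E (g u))); rewrite -gG; split=> [[v fv /(can_inj (pautKV g)) <-]//|fu].
by exists u.
Qed.

Lemma based_figure : exists x y (kappa : V -> Q),
  [/\ Psi x, rank x = 0%R, largest_face y, section_embedding x y kappa &
      forall A, Psi (kappa A) <-> simplex_flag 1%g A].
Proof.
have [y ly] := ex_largest hQ.
have [|x Px rx] := @flag_face _ _ hQ Psi 0%R fPsi; first by lia.
have [kappa emb] := section_embedding_exists hQ gV (figuresQ rx ly).
have outside z : Psi z -> [\/ exists u, z = kappa u, smallest_face z | largest_face z].
  move=> Pz; have [xz|zx] := leP 0%R (rank z).
    apply: Or31; apply/(embedding_image emb); rewrite ly andbT.
    by apply: (chain_rank_le hQ fPsi.1) => //; rewrite rx.
  by apply/Or32/(smallest_rank hQ); have := rank_bounds hQ z; lia.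
have [p pG] := simplex_flag_exists (preimage_flag emb fPsi outside).
exists x, y, (kappa \o simplex_act p); split=> //; first exact: section_embedding_comp.
move=> A; have E B : Psi (kappa B) <-> [set B | Psi (kappa B)]%classic B by [].
have act k : p @: initial 1%g k = initial p k.
  by rewrite imset_initial mul1g.
apply: (iff_trans (E (simplex_act p A))); rewrite pG; split=> -[k kn e]; exists k => //.
  by apply: (can_inj (pautKV (simplex_act p))); rewrite e simplex_actE act.
by rewrite e simplex_actE act.
Qed.

(** The extension morphisms of the facet and of the vertex-figure give psi and
    theta.  They agree on the permutations of the leaves of the facet because
    the facet and the vertex-figure meet in a Boolean lattice, on which the two
    identifications coincide by [boolean_rigid]. *)
Lemma universal_morphism : exists f : paut P -> paut Q,
  {morph f : g h / (g * h)%g} /\ distinguished_generators Psi (f \o @star_gen n.+1).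
Proof.
have cPsi := fPsi.1.
have [x0 [y [iota [sx0 Py ry embF iotaPsi]]]] := based_facet.
have [x [y1 [kappa [Px rx ly1 embV kappaPsi]]]] := based_figure.
have rx0 := rank_smallest hQ sx0.
have iota_rank u : rank (iota u) = rank u.
  by rewrite (embedding_rank embF) rx0; lia.
have kappa_rank (A : {set 'I_n.+1}) : rank (kappa A) = (#|A|%:Z)%R.
  by rewrite (embedding_rank embV) rx simplex_rankE; lia.
have iota_initial k : (k <= n)%N -> Psi (iota (star_face (initial 1%g k) 1%g)).
  by move=> kn; apply/iotaPsi; right; exists k.
have kappa_initial k : (k <= n.+1)%N -> Psi (kappa (initial 1%g k)).
  by move=> kn; apply/kappaPsi; exists k.
have PsiF z : Psi z -> largest_face z \/ exists2 u, star_flag 1%g 1%g u & z = iota u.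
  move=> Pz; have [zn|nz] := leP (rank z) (n%:Z)%R.
    have [u zE] : exists u, z = iota u.
      apply/(embedding_image embF); rewrite sx0.
      by apply: (chain_rank_le hQ cPsi) => //; rewrite ry.
    by right; exists u => //; apply/iotaPsi; rewrite -zE.
  by left; apply/(largest_rank hQ); have := rank_bounds hQ z; lia.
have PsiV z : Psi z -> smallest_face z \/ exists2 k, (k <= n.+1)%N & z = kappa (initial 1%g k).
  move=> Pz; have [xz|zx] := leP 0%R (rank z).
    have [A zE] : exists A, z = kappa A.
      apply/(embedding_image embV); rewrite ly1 andbT.
      by apply: (chain_rank_le hQ cPsi) => //; rewrite rx.
    right; have /kappaPsi[k kn AE] : Psi (kappa A) by rewrite -zE.
    by exists k => //; rewrite zE AE.
  by left; apply/(smallest_rank hQ); have := rank_bounds hQ z; lia.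
have outF z : Psi z -> [\/ exists u, z = iota u, smallest_face z | largest_face z].
  by move=> /PsiF[lz|[u _ ->]]; [apply: Or33|apply: Or31; exists u].
have outV z : Psi z -> [\/ exists u, z = kappa u, smallest_face z | largest_face z].
  by move=> /PsiV[lz|[k _ ->]]; [apply: Or32|apply: Or31; exists (initial 1%g k)].
have Px0 : Psi x0 := smallest_flag fPsi sx0.
have Py1 : Psi y1 := largest_flag fPsi ly1.
have [||EF [EFM EFE]] :=
  @extension_morphism n.+1 Q F x0 y iota Psi gF embF fPsi outF _ Px0 Py regQ.
- exact: sx0.
- move=> g fix_g; apply: (paut_rigid (star_polytope n) (star_flagP 1%g 1%g)) => u fu.
  by apply: fix_g; apply/iotaPsi.
have [||EV [EVM EVE]] :=
  @extension_morphism n.+1 Q V x y1 kappa Psi gV embV fPsi outV _ Px Py1 regQ.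
- exact: ly1.
- move=> g fix_g; apply: simplex_rigid => k kn.
  by apply: fix_g; apply: kappa_initial.
pose psi (a : 'S_n.+1) (s : 'S_n) := EF (star_act a s).
pose theta (s : 'S_n.+1) := EV (simplex_act s).
have psiM a s a' s' : psi (a * a')%g (s * s')%g = (psi a s * psi a' s')%g.
  by rewrite /psi star_actM EFM.
have thetaM : {morph theta : s t / (s * t)%g}.
  by move=> s t; rewrite /theta simplex_actM EVM.
have thetaE s (A : {set 'I_n.+1}) : theta s (kappa A) = kappa (s @: A) by rewrite EVE.
have psiE a s J b : psi a s (iota (star_face J b)) =
    iota (star_face (s @: J) ((hub_lift s)^-1 * b * a)%g).
  by rewrite EFE star_act_face.
have kappa_inj (A B : {set 'I_n.+1}) : kappa A = kappa B -> A = B.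
  move=> e; apply/eqP.
  by rewrite finset.eqEsubset -!simplex_leE -!(embedding_le embV) e lexx.
(* The faces of the facet above the base vertex also belong to the vertex-figure. *)
have iota_kappa (J : {set 'I_n}) : iota (star_face J 1%g) = kappa (lift ord_max @: J).
  have /choice[f fE] (K : {set 'I_n}) :
      exists A : {set 'I_n.+1}, iota (star_face K 1%g) = kappa A.
    apply/(embedding_image embV); rewrite ly1 andbT.
    have -> : x = iota (star_face (initial 1%g 0) 1%g).
      apply: (chain_rank_inj hQ cPsi) => //; first exact: iota_initial.
      by rewrite rx iota_rank star_face_rank card_initial.
    rewrite (embedding_le embF); apply/star_face_le; split=> //.
    by apply/subsetP => j; rewrite mem_initial ltn0.
  rewrite fE (@boolean_rigid _ _ (lift ord_max) f) //; first exact: lift_inj.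
  - move=> A B; rewrite -simplex_leE -(embedding_le embV) -!fE (embedding_le embF).
    by apply/idP/idP => [/star_face_le[]//|AB]; apply/star_face_le.
  - move=> A; have := congr1 (@rank Q) (fE A).
    by rewrite iota_rank kappa_rank star_face_rank => -[->].
  move=> k kn; have liftE : lift ord_max @: (initial 1%g k : {set 'I_n}) = initial 1%g k.
    apply/setP => j; rewrite mem_initial invg1 perm1; apply/imsetP/idP => [[i]|jk].
      rewrite mem_initial invg1 perm1 => ik ->.
      by rewrite /= /bump [(n <= i)%N]leqNgt ltn_ord.
    have jn : (j < n)%N by apply: leq_trans kn.
    exists (Ordinal jn); first by rewrite mem_initial invg1 perm1.
    by apply: val_inj; rewrite /= /bump leqNgt jn.
  rewrite liftE; apply: kappa_inj; rewrite -fE.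
  apply: (chain_rank_inj hQ cPsi); [exact: iota_initial | |].
    by apply: kappa_initial; apply: leqW.
  by rewrite iota_rank kappa_rank star_face_rank !card_initial // leqW.
have agree (s : 'S_n) : psi (hub_lift s) s = theta (widen_perm s).
  apply: (paut_eq_flag hQ fPsi) => z /PsiF[lz|[u]]; first by rewrite !paut_largest.
  move=> [->|[k kn ->]] ->.
    have -> : iota None = x0.
      by apply/esym/(le_rank_eq hQ); [apply: sx0 | rewrite iota_rank rx0].
    by rewrite !paut_smallest.
  rewrite psiE mulg1 mulVg !iota_kappa thetaE -!imset_comp; congr kappa.
  by apply: eq_imset => j /=; rewrite /widen_perm lift_perm_lift.
(* The generator of rank 0 of the facet. *)
pose tau := psi (startr (ord0 : 'I_n)) 1%g.
have tau_fix : fixes_off Psi tau 0%R.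
  move=> z /PsiF[lz|[u fu zE]] rz; first by rewrite paut_largest.
  move: fu => [uE|[k kn uE]]; rewrite zE; first by rewrite /tau /psi EFE uE.
  rewrite uE /tau psiE hub_lift1 invg1 !mul1g; congr iota; apply/star_face_eq; split.
    by rewrite -[RHS]imset_id; apply: eq_imset => j; rewrite perm1.
  move=> j jk; rewrite /startr perm1 tpermD ?neq_lift // (inj_eq lift_inj).
  apply: contraNneq jk => <-; rewrite mem_initial invg1 perm1 lt0n.
  apply/eqP => k0; apply: rz; rewrite zE uE iota_rank star_face_rank k0 card_initial //.
have theta_fix (i i' : 'I_n.+1) : i' = i.+1 :> nat ->
    fixes_off Psi (theta (tperm i i')) (i.+1%:Z)%R.
  move=> ii z /PsiV[sz|[k kn zE]] rz; first by rewrite paut_smallest.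
  rewrite zE thetaE; congr kappa; have ki : k != i.+1.
    by apply/eqP => ki; apply: rz; rewrite zE kappa_rank card_initial // ki.
  by rewrite imset_initial mul1g -[RHS](initial_eq_swap _ ii ki) mulg1.
(* On the base flag, tau moves the vertex only and the last transposition moves
   the facet only; the ranks 0 and n differ by at least 2. *)
have commute_last : commute tau
    (theta (tperm (lift ord_max (ord_max : 'I_n)) (ord_max : 'I_n.+1))).
  have prevE : (lift ord_max (ord_max : 'I_n) : 'I_n.+1) = m.+2 :> nat.
    by rewrite /= /bump leqNgt ltnSn.
  have ii : (ord_max : 'I_n.+1) = (lift ord_max (ord_max : 'I_n) : 'I_n.+1).+1 :> nat.
    by rewrite prevE.
  have := theta_fix _ _ ii; rewrite prevE => last_fix.
  by apply: (generators_commute hQ fPsi _ _ _ tau_fix last_fix); rewrite /n; lia.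
have [f [fM f_tau f_theta]] :=
  @star_group_morphism m (paut Q) psi theta psiM thetaM agree commute_last.
have [dec [decM decK _]] := @star_act_decomposition n.+1.
exists (fun g => f (dec g).1 (dec g).2); split.
  by move=> g h; rewrite decM; apply: fM.
move=> i; rewrite /comp /star_gen; case: eqP => i0; rewrite decK /=.
  have -> : i = ord0 by apply: val_inj.
  rewrite f_tau; apply: (adjacent_image hQ fPsi (z := iota (star_face (initial 1%g 0) 1%g))).
  - exact: iota_initial.
  - by rewrite iota_rank star_face_rank card_initial.
  - rewrite /tau psiE => /(congr1 (fun z => z <= iota (star_face (initial 1%g 0) 1%g))).
    rewrite !(embedding_le embF) lexx => /star_face_le[_ /(_ ord0)].
    rewrite mem_initial ltn0 => /(_ isT); rewrite hub_lift1 invg1 !mul1g perm1 tpermR => /eqP.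
    by rewrite eq_sym leaf_neq0.
  - exact: tau_fix.
have ii : i = (ord_prev i).+1 :> nat by rewrite /=; lia.
have iq := ltn_ord i.
rewrite f_theta {1}ii; apply: (adjacent_image hQ fPsi (z := kappa (initial 1%g i))).
- by apply: kappa_initial; apply: ltnW.
- by rewrite kappa_rank card_initial -?ii // ltnW.
- rewrite thetaE => /(congr1 (fun z => z <= kappa (initial 1%g i))).
  rewrite !(embedding_le embV) lexx simplex_leE => /subsetP/(_ i).
  rewrite mem_initial invg1 perm1 ltnn; have : i \in tperm (ord_prev i) i @: initial 1%g i.
    apply/imsetP; exists (ord_prev i); last by rewrite tpermL.
    by rewrite mem_initial invg1 perm1 [X in (_ < X)%N]ii.
  by move=> -> /(_ isT).
- exact: theta_fix.
Qed.

End Universality.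

Theorem theorem7 (q : nat) (hq : (4 <= q)%N) :
  is_universal q (graphicahedron (star q))
    (graphicahedron (star q.-1)) (simplex q.-1) /\
  group_iso (paut (graphicahedron (star q))) ('S_q.+1 * 'S_q)%type.
Proof.
split; last exact: star_group_iso.
have [m ->] : exists m, q = m.+4 by exists (q - 4)%N; lia.
move=> {q hq}; have regP := star_regular m.+4; split=> //=.
- exact: star_has_facets.
- exact: star_has_vertex_figures.
move=> Q regQ facetsQ figuresQ.
have f0 := star_flagP (1%g : 'S_m.+4) 1%g; have gen0 := @star_gen_distinguished m.+4.
split.
  have [x _] := ex_smallest regQ.1; have [Psi fPsi _] := face_in_flag x.
  have [f [fM fgen]] := universal_morphism regQ fPsi facetsQ figuresQ.
  exact: (quotient_of_morphism fM regP regQ f0 fPsi gen0 fgen).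
move=> Phi Psi fPhi fPsi.
have [f [fM fgen]] := universal_morphism regQ fPsi facetsQ figuresQ.
(* The morphism was built for the base flag; conjugate it to reach Phi. *)
have [a aPhi] := regP.2 _ _ f0 fPhi.
have [|F FE] := @multiplicative_exists _ _ (fun g => f (a * g * a^-1)%g).
  by move=> g h; rewrite -fM !mulgA mulgVK.
exists F; split=> [h|rho sigma rhoP sigmaQ j].
  have [g <-] := morphism_onto fM regP regQ f0 fPsi gen0 fgen h.
  by exists (a^-1 * g * a)%g; rewrite FE !mulgA mulgV mul1g mulgK.
have e : (a * rho j * a^-1)%g = star_gen j.
  rewrite -aPhi in rhoP.
  exact: (distinguished_unique regP.1 f0 (distinguished_conj regP.1 rhoP) gen0 j).
by rewrite FE e -(distinguished_unique regQ.1 fPsi fgen sigmaQ).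
Qed.
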